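(* Let $V$ be an irreducible finite-dimensional $\mathbf U_q$-module (of type 1, so that $V\cong V(\boldsymbol\pi)$, where $\boldsymbol\pi$ is an $n$-tuple of polynomials with constant term $1$ which split over $\mathbf C(q)$), and let $d\in\mathbf Z$. Then there exist $v\in V$ and a unique positive integer $m$ such that, as $\mathbf U_q^e$-modules, $$L(V;d)=\bigoplus_{s=0}^{m-1}\mathbf U_q^e.(v\otimes t^s),$$ where $\mathbf U_q^e.(v\otimes t^s)$ is an irreducible $\mathbf U_q^e$-module for all $0\le s\le m-1$.
   Context: Let $\mathfrak g$ be a complex finite-dimensional simple Lie algebra of rank $n$, $I=\{1,\dots,n\}$, Cartan matrix $(a_{ij})$, $d_i$ positive integers with $(d_ia_{ij})$ symmetric, fundamental weights $\varpi_i$, weight lattice $P=\sum_i\mathbf Z\varpi_i$. Let $q$ be an indeterminate, $q_i=q^{d_i}$, $[k]_i=\frac{q_i^k-q_i^{-k}}{q_i-q_i^{-1}}$, with $[k]_i!$ and ${k\brack r}_i$ the corresponding $q_i$-factorials and $q_i$-binomials. $\mathbf U_q^e$ (the extended quantum loop algebra, i.e. the quotient of the quantum affine algebra of $\mathfrak g$ obtained by setting $C^{\pm1/2}=1$) is the associative $\mathbf C(q)$-algebra with generators $x^\pm_{i,r}$ ($i\in I,r\in\mathbf Z$), $K_i^{\pm1}$, $D^{\pm1}$, $h_{i,r}$ ($i\in I$, $r\in\mathbf Z\setminus\{0\}$) and relations: the $K_i$, $D$ are invertible and commute with each other; $K_ih_{j,r}=h_{j,r}K_i$; $K_ix^\pm_{j,r}K_i^{-1}=q_i^{\pm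 a_{ij}}x^\pm_{j,r}$; $Dx^\pm_{i,r}D^{-1}=q^rx^\pm_{i,r}$, $Dh_{i,r}D^{-1}=q^rh_{i,r}$; $[h_{i,r},h_{j,s}]=0$; $[h_{i,r},x^\pm_{j,s}]=\pm\frac1r[ra_{ij}]_ix^\pm_{j,r+s}$; $x^\pm_{i,r+1}x^\pm_{j,s}-q_i^{\pm a_{ij}}x^\pm_{j,s}x^\pm_{i,r+1}=q_i^{\pm a_{ij}}x^\pm_{i,r}x^\pm_{j,s+1}-x^\pm_{j,s+1}x^\pm_{i,r}$; $[x^+_{i,r},x^-_{j,s}]=\delta_{ij}\frac{\psi^+_{i,r+s}-\psi^-_{i,r+s}}{q_i-q_i^{-1}}$; and for $i\neq j$, $p=1-a_{ij}$ and all integers $r_1,\dots,r_p,s$: $\sum_{\sigma\in\Sigma_p}\sum_{k=0}^p(-1)^k{p\brack k}_ix^\pm_{i,r_{\sigma(1)}}\cdots x^\pm_{i,r_{\sigma(k)}}x^\pm_{j,s}x^\pm_{i,r_{\sigma(k+1)}}\cdots x^\pm_{i,r_{\sigma(p)}}=0$, where $\Sigma_p$ is the symmetric group on $p$ letters. Here $\sum_{r\ge0}\psi^\pm_{i,\pm r}u^{\pm r}=K_i^{\pm1}\exp(\pm(q_i-q_i^{-1})\sum_{s\ge1}h_{i,\pm s}u^{\pm s})$ and $\psi^\pm_{i,\mp r}=0$ for $r>0$. $\mathbf U_q\subset\mathbf U_q^e$ is the subalgebra generated by all $x^\pm_{i,r},h_{i,r},K_i^{\pm1}$; $(\mathbf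 U_q)_k=\{x\in\mathbf U_q: DxD^{-1}=q^kx\}$. Elements $P_{i,\pm r}$ are the coefficients of $u^r$ in $P_i^\pm(u)=\exp\left(-\sum_{k\ge1}\frac{q^{\pm k}h_{i,\pm k}}{[k]_i}u^k\right)$. A $\mathbf U_q$-module $V$ is of type 1 if it is the direct sum of the weight spaces $V_\mu=\{v:K_iv=q_i^{\mu_i}v\ \forall i\}$, $\mu=\sum\mu_i\varpi_i\in P$. For an $n$-tuple $\boldsymbol\pi=(\pi_1,\dots,\pi_n)$ of polynomials in $\mathbf C(q)[u]$ with constant term $1$, put $\pi_i^+=\pi_i$ and $\pi_i^-(u)=u^{\deg\pi_i}\pi_i(u^{-1})/\left.(u^{\deg\pi_i}\pi_i(u^{-1}))\right|_{u=0}$. $V(\boldsymbol\pi)$ is the unique irreducible $\mathbf U_q$-module generated by a vector $v_{\boldsymbol\pi}\ne0$ with $x^+_{i,k}v_{\boldsymbol\pi}=0$, $K_iv_{\boldsymbol\pi}=q_i^{\deg\pi_i}v_{\boldsymbol\pi}$, $P_i^\pm(u)v_{\boldsymbol\pi}=\pi_i^\pm(u)v_{\boldsymbol\pi}$ for all $i\in I$, $k\in\mathbf Z$; it is finite-dimensional. For a type 1 $\mathbf U_q$-module $V$ and $d\in\mathbf Z$, $L(V;d)$ is the $\mathbf U_q^e$-module $V\otimes\mathbf C(q)[t,t^{-1}]$ with $x(v\otimes t^r)=(xv)\otimes t^{r+k}$ for $x\in(\mathbf U_q)_k$ and $D(v\otimes t^r)=q^{d+r}v\otimes t^r$.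
   Formalization: The trivial module is excluded (some π_i ≠ 1 is assumed): for V = V(1,…,1), of dimension 1, each U_q^e.(v⊗t^s) has dimension at most 1 while L(V;d) is infinite-dimensional, so no finite m exists. *)

(* Defs.v *)
From HB Require Import structures.
From mathcomp Require Import all_boot all_order perm all_algebra.
From mathcomp Require Import generic_quotient ring_quotient.
From mathcomp Require Import boolp classical_sets reals.
From mathcomp Require Import finmap.
From mathcomp.multinomials Require Import monalg.
From mathcomp.real_closed Require Import complex.
From mathcomp Require Import ring.

Set Implicit Arguments.
Unset Strict Implicit.
Unset Printing Implicit Defensive.

Import Order.TTheory GRing.Theory Num.Theory.
Local Open Scope ring_scope.
Local Open Scope quotient_scope.

(* ------------------------------------------------------------------ *)
Lemma cat_unit (G : Type) (v w : seq G) : v ++ w = [::] -> v = [::] /\ w = [::].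
Proof. by case: v => //; case: w. Qed.
HB.instance Definition _ (G : choiceType) := Choice_isMonomialDef.Build (seq G)
  (@catA G) (@cat0s G) (@cats0 G) (@cat_unit G).

(* free associative algebra on G: the algebra of the free monoid of words *)
Notation freeAlg F G := {malg F[seq G]}.

Lemma malg_scalerAr (R : comNzRingType) (K : monomType) (c : R)
  (a b : {malg R[K]}) : c *: (a * b) = a * (c *: b).
Proof.
rewrite -!mul_malgC !mulrA; congr (_ * _).
rewrite (monalgE a) mulr_suml mulr_sumr; apply: eq_bigr => k _.
by rewrite !malgM_def !fgmulUU mulrC mul1m mulm1.
Qed.

Section FreeAlg.
Variables (F : fieldType) (G : choiceType).
Local Notation T := (freeAlg F G).

Definition fgen (x : G) : T := << [:: x] >>.

Inductive ideal2 (r : T -> T -> Prop) : T -> Prop :=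
| ideal2_gen a b c e : r a b -> ideal2 r (c * (a - b) * e)
| ideal2_0 : ideal2 r 0
| ideal2_D a b : ideal2 r a -> ideal2 r b -> ideal2 r (a + b).

Lemma ideal2_Ml r a b : ideal2 r b -> ideal2 r (a * b).
Proof.
elim=> [x y c e rxy||x y _ hx _ hy].
- by rewrite !mulrA; apply: ideal2_gen.
- by rewrite mulr0; apply: ideal2_0.
- by rewrite mulrDr; apply: ideal2_D.
Qed.

Lemma ideal2_Mr r a b : ideal2 r a -> ideal2 r (a * b).
Proof.
elim=> [x y c e rxy||x y _ hx _ hy].
- by rewrite -!mulrA mulrA; apply: ideal2_gen.
- by rewrite mul0r; apply: ideal2_0.
- by rewrite mulrDl; apply: ideal2_D.
Qed.

Lemma ideal2_rel (r : T -> T -> Prop) a b : r a b -> ideal2 r (a - b).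
Proof. by move/(ideal2_gen 1 1); rewrite mul1r mulr1. Qed.

Record presentation := Presentation {
  prel :> T -> T -> Prop;
  prel_nontriv : ~ ideal2 prel 1 }.

Section PresentedAlgebra.
Variable p : presentation.

Definition pideal : {pred T} := fun a => `[< ideal2 p a >].

Fact pideal_zmod_closed : zmod_closed pideal.
Proof.
split; first exact/asboolP/ideal2_0.
move=> a b /asboolP ha /asboolP hb; apply/asboolP.
by apply: ideal2_D => //; rewrite -mulN1r; apply: ideal2_Ml.
Qed.
HB.instance Definition _ := GRing.isZmodClosed.Build T pideal pideal_zmod_closed.

Definition presAlg : Type := Quotient.quot pideal.
HB.instance Definition _ := GRing.Zmodule.on presAlg.

Definition pres_pi (a : T) : presAlg := \pi_(Quotient.quot pideal) a.
Definition pres_repr (u : presAlg) : T := repr (u : Quotient.quot pideal).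

Lemma pres_reprK u : pres_pi (pres_repr u) = u.
Proof. exact: reprK. Qed.

Lemma pres_piP a b : pres_pi a = pres_pi b <-> ideal2 p (a - b).
Proof.
split => [/eqmodP|h]; first by rewrite /= Quotient.equivE => /asboolP.
by apply/eqmodP; rewrite /= Quotient.equivE; apply/asboolP.
Qed.

Lemma pres_piB : {morph pres_pi : a b / a - b}.
Proof. by move=> a b; rewrite /pres_pi Quotient.pi_add Quotient.pi_opp. Qed.
HB.instance Definition _ := GRing.isZmodMorphism.Build T presAlg pres_pi pres_piB.

Fact pres_key : unit. Proof. exact: tt. Qed.
Definition pres_one := pres_pi 1.
Definition pres_mul :=
  locked_with pres_key (fun u v => pres_pi (pres_repr u * pres_repr v)).
Definition pres_scale :=
  locked_with pres_key (fun c u => pres_pi (c *: pres_repr u)).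

Lemma pres_piM a b : pres_pi (a * b) = pres_mul (pres_pi a) (pres_pi b).
Proof.
set a' := pres_repr (pres_pi a); set b' := pres_repr (pres_pi b).
have ha : ideal2 p (a - a') by apply/pres_piP; rewrite pres_reprK.
have hb : ideal2 p (b - b') by apply/pres_piP; rewrite pres_reprK.
rewrite /pres_mul unlock; apply/pres_piP; rewrite -/a' -/b'.
have -> : a * b - a' * b' = a * (b - b') + (a - a') * b'.
  by rewrite mulrBr mulrBl addrA subrK.
by apply: ideal2_D; [apply: ideal2_Ml | apply: ideal2_Mr].
Qed.

Lemma pres_piZ c a : pres_pi (c *: a) = pres_scale c (pres_pi a).
Proof.
rewrite /pres_scale unlock; apply/pres_piP; rewrite -scalerBr -mul_malgC; apply: ideal2_Ml.
by apply/pres_piP; rewrite pres_reprK.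
Qed.

Lemma pres_ind (P : presAlg -> Prop) :
  (forall a, P (pres_pi a)) -> forall u, P u.
Proof. by move=> h u; rewrite -(pres_reprK u). Qed.

Fact pres_mulA : associative pres_mul.
Proof.
elim/pres_ind => a; elim/pres_ind => b; elim/pres_ind => c.
by rewrite -!pres_piM mulrA.
Qed.
Fact pres_mul1 : left_id pres_one pres_mul.
Proof. by elim/pres_ind => a; rewrite -pres_piM mul1r. Qed.
Fact pres_mulr1 : right_id pres_one pres_mul.
Proof. by elim/pres_ind => a; rewrite -pres_piM mulr1. Qed.
Fact pres_mulDl : left_distributive pres_mul +%R.
Proof.
elim/pres_ind => a; elim/pres_ind => b; elim/pres_ind => c.
by rewrite -raddfD -!pres_piM mulrDl raddfD.
Qed.
Fact pres_mulDr : right_distributive pres_mul +%R.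
Proof.
elim/pres_ind => a; elim/pres_ind => b; elim/pres_ind => c.
by rewrite -raddfD -!pres_piM mulrDr raddfD.
Qed.
Fact pres_1neq0 : pres_one != 0.
Proof.
apply/eqP; rewrite -(raddf0 pres_pi) => /pres_piP; rewrite subr0.
exact: prel_nontriv.
Qed.
HB.instance Definition _ := GRing.Zmodule_isNzRing.Build presAlg
  pres_mulA pres_mul1 pres_mulr1 pres_mulDl pres_mulDr pres_1neq0.

Fact pres_pi_monoid : monoid_morphism pres_pi.
Proof. by split=> [|a b]; [reflexivity | exact: pres_piM]. Qed.
HB.instance Definition _ :=
  GRing.isMonoidMorphism.Build T presAlg pres_pi pres_pi_monoid.

Fact pres_scaleA c d u : pres_scale c (pres_scale d u) = pres_scale (c * d) u.
Proof. by elim/pres_ind: u => a; rewrite -!pres_piZ scalerA. Qed.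
Fact pres_scale1 : left_id 1 pres_scale.
Proof. by elim/pres_ind => a; rewrite -pres_piZ scale1r. Qed.
Fact pres_scaleDr : right_distributive pres_scale +%R.
Proof.
move=> c; elim/pres_ind => a; elim/pres_ind => b.
by rewrite -raddfD -!pres_piZ scalerDr raddfD.
Qed.
Fact pres_scaleDl u : {morph pres_scale^~ u : c d / c + d}.
Proof. by elim/pres_ind: u => a c d; rewrite -!pres_piZ scalerDl raddfD. Qed.
HB.instance Definition _ := GRing.Zmodule_isLmodule.Build F presAlg
  pres_scaleA pres_scale1 pres_scaleDr pres_scaleDl.

Fact pres_pi_scalable : scalable pres_pi.
Proof. by move=> c a; rewrite pres_piZ. Qed.
HB.instance Definition _ :=
  GRing.isScalable.Build F T presAlg *:%R pres_pi pres_pi_scalable.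

Fact pres_scalerAl c (u v : presAlg) : c *: (u * v) = c *: u * v.
Proof.
elim/pres_ind: u => a; elim/pres_ind: v => b.
by rewrite -rmorphM -!linearZ -rmorphM scalerAl.
Qed.
HB.instance Definition _ :=
  GRing.Lmodule_isLalgebra.Build F presAlg pres_scalerAl.

Fact pres_scalerAr c (u v : presAlg) : c *: (u * v) = u * (c *: v).
Proof.
elim/pres_ind: u => a; elim/pres_ind: v => b.
by rewrite -rmorphM -!linearZ -rmorphM malg_scalerAr.
Qed.
HB.instance Definition _ :=
  GRing.Lalgebra_isAlgebra.Build F presAlg pres_scalerAr.

End PresentedAlgebra.
End FreeAlg.

(* ------------------------------------------------------------------ *)
Section GeneratedSubalgebra.
Variables (F : fieldType) (A : algType F) (S : A -> Prop).

Inductive in_subalg : A -> Prop :=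
| in_subalg_gen a : S a -> in_subalg a
| in_subalg_1 : in_subalg 1
| in_subalg_lin c a b : in_subalg a -> in_subalg b -> in_subalg (c *: a + b)
| in_subalg_mul a b : in_subalg a -> in_subalg b -> in_subalg (a * b).

Definition subalg_pred : {pred A} := fun a => `[< in_subalg a >].

Fact subalg_pred_closed : subalg_closed subalg_pred.
Proof.
split; first exact/asboolP/in_subalg_1.
- by move=> c a b /asboolP ha /asboolP hb; exact/asboolP/in_subalg_lin.
- by move=> a b /asboolP ha /asboolP hb; exact/asboolP/in_subalg_mul.
Qed.
HB.instance Definition _ :=
  GRing.isSubalgClosed.Build F A subalg_pred subalg_pred_closed.

Record subalg := Subalg { subalg_val :> A; _ : subalg_val \in subalg_pred }.
HB.instance Definition _ := [isSub for subalg_val].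
HB.instance Definition _ := [Choice of subalg by <:].
HB.instance Definition _ := [SubChoice_isSubAlgebra of subalg by <:].

Lemma subalgP (a : subalg) : in_subalg (val a).
Proof. exact/asboolP/(valP a). Qed.

Definition subalg_of a (Sa : S a) : subalg :=
  Subalg (introT (asboolP _) (in_subalg_gen Sa)).
End GeneratedSubalgebra.

(* ------------------------------------------------------------------ *)
(* Coefficient of u^r in exp (\sum_(s >= 1) a s u^s); the terms k > r do not
   contribute. *)
Definition exp_coef (F : fieldType) (T : lalgType F) (a : nat -> T) (r : nat) : T :=
  \sum_(k < r.+1) (k`!%:R : F)^-1 *:
    ((\poly_(s < r.+1) (if s == 0%N then 0 else a s)) ^+ k)`_r.

Definition sgi (b : bool) : int := if b then 1 else -1.

Section QuantumLoopAlgebra.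
Variables (F : fieldType) (q : F) (n : nat) (A : 'M[int]_n) (d : 'I_n -> nat).

Definition qi (i : 'I_n) : F := q ^+ d i.
Definition qnum (i : 'I_n) (k : int) : F :=
  (qi i ^ k - qi i ^ (- k)) / (qi i - (qi i)^-1).
Definition qfact (i : 'I_n) (k : nat) : F := \prod_(1 <= j < k.+1) qnum i j.
Definition qbinom (i : 'I_n) (p k : nat) : F :=
  qfact i p / (qfact i k * qfact i (p - k)).

Inductive Ugen :=
| GX (b : bool) (i : 'I_n) (r : int)
| GH (i : 'I_n) (r : {r : int | r != 0})
| GK (b : bool) (i : 'I_n)
| GD (b : bool).
HB.instance Definition _ := gen_eqMixin Ugen.
HB.instance Definition _ := gen_choiceMixin Ugen.

Local Notation T := (freeAlg F Ugen).
Local Notation x b i r := (fgen F (GX b i r)).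
Local Notation K i := (fgen F (GK true i)).
Local Notation K' i := (fgen F (GK false i)).
Local Notation D := (fgen F (GD true)).
Local Notation D' := (fgen F (GD false)).

Definition freeH (i : 'I_n) (r : int) : T :=
  if insub r is Some r' then fgen F (GH i r') else 0.
Local Notation h := freeH.

Definition psi (b : bool) (i : 'I_n) (r : int) : T :=
  if 0 <= sgi b * r then
    fgen F (GK b i) *
    exp_coef (fun s => ((sgi b)%:~R * (qi i - (qi i)^-1)) *: h i (sgi b * s)) `|r|
  else 0.

Definition serre_deg (i j : 'I_n) : nat := `|1 - A i j|%N.

Inductive Urel : T -> T -> Prop :=
| Urel_KK' i : Urel (K i * K' i) 1
| Urel_K'K i : Urel (K' i * K i) 1
| Urel_DD' : Urel (D * D') 1
| Urel_D'D : Urel (D' * D) 1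
| Urel_KK i j : Urel (K i * K j) (K j * K i)
| Urel_KD i : Urel (K i * D) (D * K i)
| Urel_KH i j r : Urel (K i * h j r) (h j r * K i)
| Urel_KX b i j r :
    Urel (K i * x b j r * K' i) ((qi i ^ (sgi b * A i j)) *: x b j r)
| Urel_DX b i r : Urel (D * x b i r * D') ((q ^ r) *: x b i r)
| Urel_DH i r : Urel (D * h i r * D') ((q ^ r) *: h i r)
| Urel_HH i j r s : Urel (h i r * h j s) (h j s * h i r)
| Urel_HX b i j r s : r != 0 ->
    Urel (h i r * x b j s - x b j s * h i r)
         (((sgi b)%:~R / r%:~R * qnum i (r * A i j)) *: x b j (r + s))
| Urel_XX b i j r s :
    Urel (x b i (r + 1) * x b j s -
            (qi i ^ (sgi b * A i j)) *: (x b j s * x b i (r + 1)))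
         ((qi i ^ (sgi b * A i j)) *: (x b i r * x b j (s + 1)) -
            x b j (s + 1) * x b i r)
| Urel_XpXm i j r s :
    Urel (x true i r * x false j s - x false j s * x true i r)
         (if i == j then
            (qi i - (qi i)^-1)^-1 *: (psi true i (r + s) - psi false i (r + s))
          else 0)
| Urel_Serre b i j (r : 'I_(serre_deg i j) -> int) s : i != j ->
    Urel (\sum_(g : 'S_(serre_deg i j)) \sum_(k < (serre_deg i j).+1)
            ((-1) ^+ k * qbinom i (serre_deg i j) k) *:
              ((\prod_(l < serre_deg i j | (l < k)%N) x b i (r (g l))) * x b j s *
               (\prod_(l < serre_deg i j | (k <= l)%N) x b i (r (g l)))))
         0.

Section Counit.

Definition eps_gen (g : Ugen) : F :=
  match g with GX _ _ _ | GH _ _ => 0 | GK _ _ | GD _ => 1 end.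
Definition eps_mon (w : seq Ugen) : F := \prod_(g <- w) eps_gen g.

Fact eps_mon_morph : mmorphism eps_mon.
Proof.
split=> [v w|]; rewrite /eps_mon; first by rewrite big_cat.
by rewrite big_nil.
Qed.
HB.instance Definition _ :=
  monalg.isMultiplicative.Build (seq Ugen) F eps_mon eps_mon_morph.

Definition eps : T -> F := mmap idfun eps_mon.
HB.instance Definition _ := GRing.RMorphism.on eps.

Lemma eps0 : eps 0 = 0. Proof. exact: raddf0. Qed.
Lemma eps1 : eps 1 = 1. Proof. exact: rmorph1. Qed.
Lemma epsD : {morph eps : a b / a + b}. Proof. exact: raddfD. Qed.
Lemma epsB : {morph eps : a b / a - b}. Proof. exact: raddfB. Qed.
Lemma epsM : {morph eps : a b / a * b}. Proof. exact: rmorphM. Qed.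
Lemma epsZ c a : eps (c *: a) = c * eps a.
Proof. exact: mmapZ. Qed.

Lemma eps_fgen g : eps (fgen F g) = eps_gen g.
Proof. by rewrite /eps /fgen mmapU mul1r /eps_mon big_seq1. Qed.

Lemma epsH i r : eps (h i r) = 0.
Proof.
by rewrite /freeH; case: insubP => [r' _ _|_]; rewrite ?eps0 ?eps_fgen.
Qed.

Lemma eps_exp (a : nat -> T) r :
  (forall s, eps (a s) = 0) -> eps (exp_coef a r) = (r == 0%N)%:R.
Proof.
move=> ha; rewrite /exp_coef (big_morph eps epsD eps0) big_ord_recl big1 => [|k _] /=.
  rewrite addr0 epsZ expr0 coef1 fact0 invr1 mul1r.
  by case: (r == 0%N); rewrite ?eps0 ?eps1.
rewrite epsZ -coef_map rmorphXn /=.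
suff -> : map_poly eps (\poly_(s < r.+1) (if s == 0%N then 0 else a s)) = 0.
  by rewrite expr0n /= coef0 mulr0.
apply/polyP => j; rewrite coef_map coef_poly coef0 /=.
by case: ifP => _; rewrite ?eps0 //; case: ifP => _; rewrite ?eps0 ?ha.
Qed.

Local Opaque fgen exp_coef.

Lemma eps_psi b i r : eps (psi b i r) = (r == 0)%:R.
Proof.
rewrite /psi; case: ifP => hr.
  rewrite epsM eps_fgen mul1r eps_exp ?absz_eq0 // => s.
  by rewrite epsZ epsH mulr0.
by rewrite eps0; case: eqP hr => // ->; rewrite mulr0 lexx.
Qed.

Lemma eps_Urel a b : Urel a b -> eps a = eps b.
Proof.
case=> {a b} /=.
- by move=> i; rewrite epsM !eps_fgen mulr1 eps1.
- by move=> i; rewrite epsM !eps_fgen mulr1 eps1.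
- by rewrite epsM !eps_fgen mulr1 eps1.
- by rewrite epsM !eps_fgen mulr1 eps1.
- by move=> i j; rewrite !epsM !eps_fgen.
- by move=> i; rewrite !epsM !eps_fgen.
- by move=> i j r; rewrite !epsM !epsH mul0r mulr0.
- by move=> b i j r; rewrite epsZ !epsM !eps_fgen /= !(mulr0, mul0r).
- by move=> b i r; rewrite epsZ !epsM !eps_fgen /= !(mulr0, mul0r).
- by move=> i r; rewrite epsZ !epsM !epsH /= !(mulr0, mul0r).
- by move=> i j r s; rewrite !epsM !epsH.
- by move=> b i j r s _; rewrite epsZ epsB !epsM !eps_fgen /= !(mulr0, mul0r, subr0).
- move=> b i j r s.
  have hx i' r' y : eps (x b i' r' * y) = 0 by rewrite epsM eps_fgen mul0r.
  transitivity (0 : F); [|symmetry]; rewrite epsB epsZ.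
    apply: etrans (congr2 (fun u v => u - _ * v) (hx _ _ _) (hx _ _ _)) _.
    by rewrite mulr0 subr0.
  apply: etrans (congr2 (fun u v => _ * u - v) (hx _ _ _) (hx _ _ _)) _.
  by rewrite mulr0 subr0.
- move=> i j r s; rewrite epsB !epsM !eps_fgen /= mulr0 subr0.
  move: (eps_psi true i (r + s)) (eps_psi false i (r + s)).
  move: (psi true i (r + s)) (psi false i (r + s)) => u v hu hv.
  case: (i == j); last by rewrite eps0.
  by rewrite epsZ epsB hu hv subrr mulr0.
- move=> b i j r s _; rewrite eps0 (big_morph eps epsD eps0) big1 // => g _.
  rewrite (big_morph eps epsD eps0) big1 // => k _.
  by rewrite epsZ !epsM eps_fgen /= !(mulr0, mul0r).
Qed.

Lemma Urel_nontriv : ~ ideal2 Urel 1.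
Proof.
suff h0 a : ideal2 Urel a -> eps a = 0.
  by move=> /h0 /eqP; rewrite eps1 oner_eq0.
elim=> [u v c e /eps_Urel uv||u v _ hu _ hv]; last by rewrite epsD hu hv addr0.
  by rewrite !epsM epsB /= uv subrr mulr0 mul0r.
by rewrite eps0.
Qed.
End Counit.

Definition Upres : presentation F Ugen := Presentation Urel_nontriv.

(* extended quantum loop algebra U_q^e *)
Definition Ue : Type := presAlg Upres.
HB.instance Definition _ := GRing.Algebra.on Ue.

Definition Ue_gen (g : Ugen) : Ue := pres_pi Upres (fgen F g).

(* quantum loop algebra U_q *)
Definition is_D (g : Ugen) : bool := if g is GD _ then true else false.
Definition Uq_gens (u : Ue) : Prop := exists2 g, ~~ is_D g & u = Ue_gen g.
Definition Uq : Type := subalg Uq_gens.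
HB.instance Definition _ := GRing.SubAlgebra.on Uq.

Definition Uq_gen (g : Ugen) (hg : ~~ is_D g) : Uq :=
  subalg_of (ex_intro2 _ _ g hg erefl).
Definition UqX b i r : Uq := @Uq_gen (GX b i r) isT.
Definition UqK b i : Uq := @Uq_gen (GK b i) isT.
Definition UqH i (r : int) : Uq :=
  if insub r is Some r' then @Uq_gen (GH i r') isT else 0.

Definition Uq_homog (k : int) (u : Uq) : Prop :=
  Ue_gen (GD true) * (val u : Ue) * Ue_gen (GD false) = (q ^ k) *: (val u : Ue).

Definition UqP (b : bool) (i : 'I_n) (r : nat) : Uq :=
  exp_coef (fun k => (- (q ^ (sgi b * k) / qnum i k)) *: UqH i (sgi b * k)) r.

End QuantumLoopAlgebra.

Arguments GX {n}. Arguments GH {n}. Arguments GK {n}. Arguments GD {n}.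

(* ------------------------------------------------------------------ *)
Section Shift.
Variables (F : fieldType) (U : algType F) (V : lmodType U).
Local Notation L := {malg V[int]}.

Definition loop_shift (k : int) (phi : int -> U) (l : L) : L :=
  \sum_(r <- msupp l) << phi r *: l@_r *g r + k >>.

Lemma loop_shiftE k phi l s :
  (loop_shift k phi l)@_s = phi (s - k) *: l@_(s - k).
Proof.
rewrite /loop_shift raddf_sum /=.
have [hs|hs] := boolP (s - k \in msupp l).
  rewrite (big_fsetD1 _ hs) /= mcoeffU subrK eqxx mulr1n big1_fset ?addr0 //.
  move=> r; rewrite !inE => /andP[hr _] _; rewrite mcoeffU.
  case: (r + k =P s) hr => [<-|_ _]; last by rewrite mulr0n.
  by rewrite addrK eqxx.
rewrite (mcoeff_outdom hs) scaler0 big1_fset // => r hr _; rewrite mcoeffU.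
case: (r + k =P s) hs => [<-|_ _]; last by rewrite mulr0n.
by rewrite addrK hr.
Qed.

Lemma loop_shiftD k phi l m :
  loop_shift k phi (l + m) = loop_shift k phi l + loop_shift k phi m.
Proof.
by apply/malgP => s; rewrite mcoeffD !loop_shiftE mcoeffD scalerDr.
Qed.

Lemma loop_shift0 k phi : loop_shift k phi 0 = 0.
Proof. by apply/malgP => s; rewrite loop_shiftE !mcoeff0 scaler0. Qed.

Lemma loop_shiftU k phi v r :
  loop_shift k phi << v *g r >> = << phi r *: v *g r + k >>.
Proof.
apply/malgP => s; rewrite loop_shiftE !mcoeffU.
have -> : (r + k == s) = (r == s - k) by rewrite eq_sym -subr_eq eq_sym.
by case: eqP => [->|_]; rewrite ?mulr1n // scaler0.
Qed.

Definition loop_scale (c : F) : L -> L := loop_shift 0 (fun=> c%:A : U).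

Lemma loop_scaleE c l s : (loop_scale c l)@_s = (c%:A : U) *: l@_s.
Proof. by rewrite loop_shiftE subr0. Qed.

Lemma loop_shift_scale k phi c l :
  loop_shift k phi (loop_scale c l) = loop_scale c (loop_shift k phi l).
Proof.
apply/malgP => s.
rewrite loop_shiftE loop_scaleE loop_scaleE loop_shiftE !scalerA.
by rewrite mulr_algl mulr_algr.
Qed.

Lemma loop_scaleA a b l : loop_scale a (loop_scale b l) = loop_scale (a * b) l.
Proof.
by apply/malgP => s; rewrite !loop_scaleE scalerA mulr_algl scalerA.
Qed.

Lemma loop_scaleDl a b l : loop_scale (a + b) l = loop_scale a l + loop_scale b l.
Proof. by apply/malgP => s; rewrite mcoeffD !loop_scaleE !scalerDl. Qed.
Lemma loop_scale0l l : loop_scale 0 l = 0.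
Proof. by apply/malgP => s; rewrite loop_scaleE mcoeff0 !scale0r. Qed.
Lemma loop_scale1 l : loop_scale 1 l = l.
Proof. by apply/malgP => s; rewrite loop_scaleE !scale1r. Qed.

Lemma expz_sub_neq0 (q : F) (a b : int) : q != 0 ->
  (forall j : int, j != 0 -> q ^ j != 1) -> a != b -> q ^ a - q ^ b != 0.
Proof.
move=> q0 hq ab; have -> : q ^ a = q ^ (a - b) * q ^ b.
  by rewrite -expfzDr // subrK.
rewrite -{2}[q ^ b]mul1r -mulrBl mulf_neq0 ?expfz_neq0 // subr_eq0 hq //.
by rewrite subr_eq0.
Qed.

Lemma scalar_eq0 (c : F) (v : V) : c != 0 -> (c%:A : U) *: v = 0 -> v = 0.
Proof.
move=> c0 /(congr1 (fun y => (c^-1)%:A *: y)).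
by rewrite scaler0 scalerA mulr_algl scalerA mulVf // scale1r scale1r.
Qed.

Lemma quasi_comm_scale (a b : U) (c e : F) (v : V) :
  a * b = c *: (b * a) -> a *: v = e%:A *: v ->
  a *: (b *: v) = (c * e)%:A *: (b *: v).
Proof.
move=> h hv; rewrite scalerA h -(mulr_algl c (b * a)) -!scalerA hv !scalerA.
by rewrite mulr_algr !mulr_algl scalerA (mulrC e).
Qed.
End Shift.

Section LoopModule.
Variables (F : fieldType) (q : F) (q_neq0 : q != 0).
Variables (n : nat) (A : 'M[int]_n) (d : 'I_n -> nat).
Local Notation Uq := (Uq q A d).
Local Notation Ue := (Ue q A d).
Local Notation T := (freeAlg F (Ugen n)).
Local Notation pi := (pres_pi (Upres q A d)).
Variable V : lmodType Uq.
Local Notation L := {malg V[int]}.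

Variable dd : int.

Definition loop_gen (g : Ugen n) : L -> L :=
  match g with
  | GX b i k => loop_shift k (fun=> UqX q A d b i k)
  | GH i k => loop_shift (val k) (fun=> UqH q A d i (val k))
  | GK b i => loop_shift 0 (fun=> UqK q A d b i)
  | GD b => loop_shift 0 (fun r => (q ^ (sgi b * (dd + r)))%:A)
  end.

Definition loop_word (w : seq (Ugen n)) (l : L) : L := foldr loop_gen l w.

Definition loop_free (a : T) (l : L) : L :=
  \sum_(w <- msupp a) loop_scale a@_w (loop_word w l).

Lemma loop_genD g l m : loop_gen g (l + m) = loop_gen g l + loop_gen g m.
Proof. by case: g => *; apply: loop_shiftD. Qed.
Lemma loop_gen0 g : loop_gen g 0 = 0.
Proof. by case: g => *; apply: loop_shift0. Qed.
Lemma loop_gen_scale g c l : loop_gen g (loop_scale c l) = loop_scale c (loop_gen g l).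
Proof. by case: g => *; apply: loop_shift_scale. Qed.

Lemma loop_wordD w l m : loop_word w (l + m) = loop_word w l + loop_word w m.
Proof. by elim: w => //= g w ->; rewrite loop_genD. Qed.
Lemma loop_word0 w : loop_word w 0 = 0.
Proof. by elim: w => //= g w ->; rewrite loop_gen0. Qed.
Lemma loop_word_scale w c l :
  loop_word w (loop_scale c l) = loop_scale c (loop_word w l).
Proof. by elim: w => //= g w ->; rewrite loop_gen_scale. Qed.

Lemma loop_freeEw (D : {fset seq (Ugen n)}) a l : (msupp a `<=` D)%fset ->
  loop_free a l = \sum_(w <- D) loop_scale a@_w (loop_word w l).
Proof.
move=> aD; apply: big_fset_incl => // w _ /mcoeff_outdom ->.
exact: loop_scale0l.
Qed.

Lemma loop_freeDl a b l : loop_free (a + b) l = loop_free a l + loop_free b l.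
Proof.
rewrite (loop_freeEw l (msuppD_le a b)) (loop_freeEw l (fsubsetUl _ (msupp b))).
rewrite (loop_freeEw l (fsubsetUr (msupp a) _)) -big_split /=.
by apply: eq_bigr => w _; rewrite mcoeffD loop_scaleDl.
Qed.

Lemma loop_free0l l : loop_free 0 l = 0.
Proof. by rewrite /loop_free msupp0 big_seq_fset0. Qed.

Lemma loop_freeU c w l : loop_free << c *g w >> l = loop_scale c (loop_word w l).
Proof.
by rewrite (loop_freeEw l msuppU_le) big_seq_fset1 mcoeffUU.
Qed.

Lemma loop_freeDr a l m : loop_free a (l + m) = loop_free a l + loop_free a m.
Proof.
rewrite /loop_free -big_split /=; apply: eq_bigr => w _.
by rewrite loop_wordD /loop_scale loop_shiftD.
Qed.

Lemma loop_free0r a : loop_free a 0 = 0.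
Proof.
by rewrite /loop_free big1 // => w _; rewrite loop_word0 /loop_scale loop_shift0.
Qed.

Lemma loop_freeM a b l : loop_free (a * b) l = loop_free a (loop_free b l).
Proof.
have f1 (I : Type) (s : seq I) (f : I -> T) :
    loop_free (\sum_(i <- s) f i) l = \sum_(i <- s) loop_free (f i) l.
  exact: (big_morph (loop_free^~ l) (fun a b => loop_freeDl a b l) (loop_free0l l)).
rewrite malgME f1 [RHS]/loop_free; apply: eq_bigr => v _.
rewrite f1 [in RHS]/loop_free (big_morph _ (loop_wordD v) (loop_word0 v)).
rewrite /loop_scale (big_morph _ (loop_shiftD 0 _) (loop_shift0 _ 0 _)).
apply: eq_bigr => w _; rewrite -/(loop_scale _ _).
by rewrite loop_freeU loop_word_scale loop_scaleA /loop_word foldr_cat.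
Qed.

Lemma loop_free1 l : loop_free 1 l = l.
Proof. by rewrite loop_freeU loop_scale1. Qed.

Lemma loop_freeZ c a l : loop_free (c *: a) l = loop_scale c (loop_free a l).
Proof. by rewrite -mul_malgC loop_freeM loop_freeU. Qed.

Lemma loop_freeN a l : loop_free (- a) l = - loop_free a l.
Proof. by apply/eqP; rewrite -addr_eq0 -loop_freeDl addNr loop_free0l. Qed.

Lemma loop_free_ext a b :
  (forall v r, loop_free a << v *g r >> = loop_free b << v *g r >>) ->
  forall l, loop_free a l = loop_free b l.
Proof.
move=> h l; rewrite (monalgE l).
rewrite !(big_morph _ (loop_freeDr _) (loop_free0r _)).
by apply: eq_bigr => r _.
Qed.

Lemma loop_free_gen g l : loop_free (fgen F g) l = loop_gen g l.
Proof. by rewrite loop_freeU loop_scale1. Qed.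

(* a represents an element of U_q acting on V (x) t^r with degree k *)
Definition lhom (k : int) (a : T) : Prop := exists u : Uq,
  (val u : Ue) = pi a /\ forall v r, loop_free a << v *g r >> = << u *: v *g r + k >>.

Lemma lhom_eq k a b : lhom k a -> lhom k b -> Urel q A d a b ->
  forall l, loop_free a l = loop_free b l.
Proof.
case=> u [hu ha] [w [hw hb]] hab; apply: loop_free_ext => v r.
rewrite ha hb; congr << _ *: _ *g _ >>; apply: val_inj; rewrite /= hu hw.
by apply/pres_piP/ideal2_rel.
Qed.

Lemma lhom0 k : lhom k 0.
Proof.
exists 0; rewrite !raddf0; split=> // v r.
by rewrite loop_free0l scale0r monalgU0.
Qed.

Lemma lhom1 : lhom 0 1.
Proof.
exists 1; rewrite !rmorph1; split=> // v r.
by rewrite loop_free1 scale1r addr0.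
Qed.

Lemma lhomD k a b : lhom k a -> lhom k b -> lhom k (a + b).
Proof.
case=> u [hu ha] [w [hw hb]]; exists (u + w); rewrite !raddfD /= hu hw.
by split=> // v r; rewrite loop_freeDl ha hb scalerDl monalgUD.
Qed.

Lemma lhomZ k c a : lhom k a -> lhom k (c *: a).
Proof.
case=> u [hu ha]; exists (c *: u); rewrite !linearZ /= hu; split=> // v r.
by rewrite loop_freeZ ha /loop_scale loop_shiftU addr0 scalerA mulr_algl.
Qed.

Lemma lhomB k a b : lhom k a -> lhom k b -> lhom k (a - b).
Proof. by move=> ha hb; rewrite -[- b]scaleN1r; apply: lhomD (lhomZ _ hb). Qed.

Lemma lhomM k l a b : lhom k a -> lhom l b -> lhom (k + l) (a * b).
Proof.
case=> u [hu ha] [w [hw hb]]; exists (u * w); rewrite !rmorphM /= hu hw.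
split=> // v r; rewrite loop_freeM hb ha scalerA.
by rewrite -addrA (addrC l).
Qed.

Lemma lhom_sum (I : Type) (s : seq I) (P : pred I) k (f : I -> T) :
  (forall i, lhom k (f i)) -> lhom k (\sum_(i <- s | P i) f i).
Proof.
move=> h; elim/big_ind: _ => [|a b|i _]; [exact: lhom0 | exact: lhomD | exact: h].
Qed.

Lemma lhom_prod (I : Type) (s : seq I) (P : pred I) (k : I -> int) (f : I -> T) :
  (forall i, lhom (k i) (f i)) ->
  lhom (\sum_(i <- s | P i) k i) (\prod_(i <- s | P i) f i).
Proof.
move=> h; elim/big_ind2: _ => [|k1 a k2 b|i _]; [exact: lhom1 | | exact: h].
by move=> ? ?; exact: lhomM.
Qed.

Lemma lhomX b i r : lhom r (fgen F (GX b i r)).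
Proof.
exists (UqX q A d b i r); split=> // v s.
by rewrite loop_free_gen /= loop_shiftU.
Qed.

Lemma lhomK b i : lhom 0 (fgen F (GK b i)).
Proof.
exists (UqK q A d b i); split=> // v s.
by rewrite loop_free_gen /= loop_shiftU.
Qed.

Lemma lhomH i r : lhom r (freeH F i r).
Proof.
rewrite /freeH; case: insubP => [k hk <-|_]; last exact: lhom0.
exists (UqH q A d i (val k)); split=> [|v s]; last by rewrite loop_free_gen /= loop_shiftU.
by rewrite /UqH valK.
Qed.

Lemma lhom_exp (c : int) (a : nat -> T) r :
  (forall s, lhom (c * s%:Z) (a s)) -> lhom (c * r%:Z) (exp_coef a r).
Proof.
move=> h; rewrite /exp_coef; apply: lhom_sum => k; apply: lhomZ.
set p := \poly_(s < _) _.
have hp j : lhom (c * j%:Z) p`_j.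
  rewrite coef_poly; case: ifP => _; last exact: lhom0.
  by case: ifP => _; [exact: lhom0 | exact: h].
move: (nat_of_ord k) p hp => {k a h} k p hp; elim: k r => [|k IH] j.
  rewrite expr0 coef1; case: eqP => [->|_]; last exact: lhom0.
  by rewrite mulr0; exact: lhom1.
rewrite exprS coefM; apply: lhom_sum => m.
have -> : c * j%:Z = c * m%:Z + c * (j - m)%N%:Z.
  by rewrite -mulrDr -PoszD subnKC // -ltnS.
exact: lhomM.
Qed.

Lemma sgiK b (r : int) : sgi b * (sgi b * r) = r.
Proof. by case: b; rewrite /sgi ?mul1r // !mulN1r opprK. Qed.

Lemma lhom_psi b i r : lhom r (psi q d b i r).
Proof.
rewrite /psi; case: ifP => hr; last exact: lhom0.
rewrite -[X in lhom X _]add0r; apply: lhomM; first exact: lhomK.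
have e : (`|r|%N)%:Z = sgi b * r.
  by rewrite -(gez0_abs hr) abszM; case: (b); rewrite /sgi ?abszN1 ?mul1n.
rewrite -[X in lhom X _](sgiK b) -e.
by apply: lhom_exp => s; apply: lhomZ; exact: lhomH.
Qed.

Lemma lhom_serre b i j (r : 'I_(serre_deg A i j) -> int) s
    (g : 'S_(serre_deg A i j)) (k : nat) :
  lhom (s + \sum_l r l)
    ((\prod_(l < serre_deg A i j | (l < k)%N) fgen F (GX b i (r (g l)))) *
     fgen F (GX b j s) *
     (\prod_(l < serre_deg A i j | (k <= l)%N) fgen F (GX b i (r (g l))))).
Proof.
have -> : s + \sum_l r l = (\sum_(l < serre_deg A i j | (l < k)%N) r (g l)) + s
    + (\sum_(l < serre_deg A i j | (k <= l)%N) r (g l)).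
  rewrite (reindex_inj (@perm_inj _ g)) (bigID (fun l : 'I__ => (l < k)%N)) /=.
  rewrite addrA [s + _]addrC; congr (_ + _).
  by apply: eq_bigl => l; rewrite -leqNgt.
apply: lhomM; last by apply: lhom_prod => l; exact: lhomX.
apply: lhomM; last exact: lhomX.
by apply: lhom_prod => l; exact: lhomX.
Qed.

Lemma loopD b v r : loop_free (fgen F (GD b)) << v *g r >> =
  << ((q ^ (sgi b * (dd + r)))%:A : Uq) *: v *g r >>.
Proof. by rewrite loop_free_gen /= loop_shiftU addr0. Qed.

Lemma loopDD b v r :
  loop_free (fgen F (GD b) * fgen F (GD (~~ b))) << v *g r >> =
  loop_free 1 << v *g r >>.
Proof.
rewrite loop_freeM loopD loopD loop_free1 scalerA mulr_algl scalerA -expfzDr //.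
have -> : sgi b * (dd + r) + sgi (~~ b) * (dd + r) = 0.
  by rewrite -mulrDl; case: b; rewrite /sgi ?subrr ?addNr mul0r.
by rewrite expr0z scale1r scale1r.
Qed.

Lemma conjD k a : lhom k a -> forall l,
  loop_free (fgen F (GD true) * a * fgen F (GD false)) l =
  loop_free ((q ^ k) *: a) l.
Proof.
case=> u [_ ha]; apply: loop_free_ext => v r.
rewrite loop_freeZ !loop_freeM loopD !ha loopD /loop_scale loop_shiftU addr0.
congr << _ *g _ >>; rewrite !scalerA; congr (_ *: _).
rewrite !mulr_algl mulr_algr scalerA -expfzDr //; congr (q ^ _ *: _).
rewrite /sgi mul1r mulN1r addrA opprD; ring.
Qed.

Lemma loop_free_rel a b : Urel q A d a b ->
  forall l, loop_free a l = loop_free b l.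
Proof.
move=> hab; move: (hab); case: hab => {a b}.
- by move=> i /lhom_eq; apply; [exact: lhomM (lhomK _ _) (lhomK _ _) | exact: lhom1].
- by move=> i /lhom_eq; apply; [exact: lhomM (lhomK _ _) (lhomK _ _) | exact: lhom1].
- move=> _; apply: loop_free_ext => v r; exact: loopDD.
- move=> _; apply: loop_free_ext => v r; exact: loopDD.
- by move=> i j /lhom_eq; apply; exact: lhomM (lhomK _ _) (lhomK _ _).
- move=> i _; apply: loop_free_ext => v r; case: (lhomK true i) => u [_ hu].
  rewrite loop_freeM loop_freeM loopD hu hu loopD !addr0.
  by rewrite !scalerA mulr_algl mulr_algr.
- move=> i j r /(@lhom_eq (0 + r)); apply; first exact: lhomM (lhomK _ _) (lhomH _ _).
  by rewrite addrC; exact: lhomM (lhomH _ _) (lhomK _ _).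
- move=> b i j r /(@lhom_eq (0 + r + 0)); apply.
    exact: lhomM (lhomM (lhomK _ _) (lhomX _ _ _)) (lhomK _ _).
  by rewrite add0r addr0; exact: lhomZ (lhomX _ _ _).
- by move=> b i r _; exact: conjD (lhomX _ _ _).
- by move=> i r _; exact: conjD (lhomH _ _).
- move=> i j r s /(@lhom_eq (r + s)); apply; first exact: lhomM (lhomH _ _) (lhomH _ _).
  by rewrite addrC; exact: lhomM (lhomH _ _) (lhomH _ _).
- move=> b i j r s hr /(@lhom_eq (r + s)); apply; last exact: lhomZ (lhomX _ _ _).
  apply: lhomB; first exact: lhomM (lhomH _ _) (lhomX _ _ _).
  by rewrite addrC; exact: lhomM (lhomX _ _ _) (lhomH _ _).
- move=> b i j r s /(@lhom_eq (r + 1 + s)); apply.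
    apply: lhomB; first exact: lhomM (lhomX _ _ _) (lhomX _ _ _).
    by rewrite addrC; exact: lhomZ (lhomM (lhomX _ _ _) (lhomX _ _ _)).
  apply: lhomB.
    have -> : r + 1 + s = r + (s + 1) by ring.
    exact: lhomZ (lhomM (lhomX _ _ _) (lhomX _ _ _)).
  have -> : r + 1 + s = (s + 1) + r by ring.
  exact: lhomM (lhomX _ _ _) (lhomX _ _ _).
- move=> i j r s /(@lhom_eq (r + s)); apply.
    apply: lhomB; first exact: lhomM (lhomX _ _ _) (lhomX _ _ _).
    by rewrite addrC; exact: lhomM (lhomX _ _ _) (lhomX _ _ _).
  case: ifP => _; last exact: lhom0.
  exact: lhomZ (lhomB (lhom_psi _ _ _) (lhom_psi _ _ _)).
- move=> b i j r s hij /(@lhom_eq (s + \sum_l r l)); apply; last exact: lhom0.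
  by apply: lhom_sum => g; apply: lhom_sum => k; apply: lhomZ; exact: lhom_serre.
Qed.

Lemma loop_free_ideal a l : ideal2 (Urel q A d) a -> loop_free a l = 0.
Proof.
move=> ha; elim: ha l => [u v c e huv|| u v _ hu _ hv] l.
- rewrite !loop_freeM loop_freeDl loop_freeN (loop_free_rel huv) subrr.
  exact: loop_free0r.
- exact: loop_free0l.
- by rewrite loop_freeDl hu hv addr0.
Qed.

Definition loop_act (u : Ue) (l : L) : L := loop_free (pres_repr u) l.

Lemma loop_act_pi a l : loop_act (pi a) l = loop_free a l.
Proof.
apply/eqP; rewrite -subr_eq0 -loop_freeN -loop_freeDl loop_free_ideal //.
apply: (iffLR (@pres_piP _ _ (Upres q A d) _ _)).
by rewrite pres_reprK.
Qed.

(* L(V; dd): finitely supported families (v_r)_(r : int) of vectors of V, the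
   family concentrated in degree r standing for v (x) t^r.  The phantom
   arguments make the U_q^e-module structure depend on dd. *)
Definition loop : Type := let _ := (q_neq0, dd) in L.
HB.instance Definition _ := GRing.Zmodule.on loop.

Fact loop_actA (u w : Ue) l : loop_act u (loop_act w l) = loop_act (u * w) l.
Proof.
elim/pres_ind: u => a; elim/pres_ind: w => b.
by rewrite -rmorphM !loop_act_pi loop_freeM.
Qed.
Fact loop_act1 : left_id 1 loop_act.
Proof. by move=> l; rewrite -(rmorph1 pi) loop_act_pi loop_free1. Qed.
Fact loop_actDr : right_distributive loop_act +%R.
Proof. by move=> u l m; apply: loop_freeDr. Qed.
Fact loop_actDl l : {morph loop_act^~ l : u w / u + w}.
Proof.
elim/pres_ind => a; elim/pres_ind => b.
by rewrite -raddfD !loop_act_pi loop_freeDl.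
Qed.
HB.instance Definition _ := GRing.Zmodule_isLmodule.Build Ue loop
  loop_actA loop_act1 loop_actDr loop_actDl.

Definition loop_tensor (v : V) (r : int) : loop := << v *g r >>.

Lemma loop_actDE v r : Ue_gen q A d (GD true) *: loop_tensor v r =
  loop_tensor (((q ^ (dd + r))%:A : Uq) *: v) r.
Proof.
have e : sgi true * (dd + r) = dd + r by rewrite /sgi mul1r.
by rewrite -[X in q ^ X]e; exact: etrans (loop_act_pi _ _) (loopD true v r).
Qed.

Definition homact (k : int) (u : Uq) := forall v r,
  (val u : Ue) *: loop_tensor v r = loop_tensor (u *: v) (r + k).

Lemma homactM k l u w : homact k u -> homact l w -> homact (k + l) (u * w).
Proof.
move=> hu hw v r.
apply: etrans (esym (scalerA (val u : Ue) (val w : Ue) _)) _.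
apply: etrans (congr1 _ (hw _ _)) _; apply: etrans (hu _ _) _.
by rewrite scalerA -addrA (addrC l).
Qed.

Lemma loop_act_scalar c (l : loop) : (c%:A : Ue) *: l = loop_scale c l :> L.
Proof.
have -> : (c%:A : Ue) = pi (c *: 1) by exact: esym (pres_piZ (Upres q A d) c 1).
by apply: etrans (loop_act_pi _ _) _; rewrite loop_freeZ loop_free1.
Qed.

Lemma homact_scalar c : homact 0 c%:A.
Proof.
move=> v r; have -> : (val (c%:A : Uq) : Ue) = pi (c *: 1).
  exact: esym (pres_piZ (Upres q A d) c 1).
apply: etrans (loop_act_pi _ _) _; rewrite loop_freeZ loop_free1.
exact: loop_shiftU.
Qed.

Lemma homact_gen g (hg : ~~ is_D g) : exists k, homact k (Uq_gen q A d hg).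
Proof.
have e l : (val (Uq_gen q A d hg) : Ue) *: (l : loop) = loop_gen g l :> loop.
  by rewrite -(loop_free_gen g l) -loop_act_pi.
case: g hg e => [b i k|i k|b i|//] hg e; [exists k|exists (val k)|exists 0];
  move=> v r; rewrite e /= loop_shiftU; congr << _ *: _ *g _ >>.
- exact: val_inj.
- by rewrite /UqH valK; exact: val_inj.
- exact: val_inj.
Qed.

Lemma homact_dec (a : Ue) : in_subalg (@Uq_gens F q n A d) a ->
  exists t : seq (int * Uq),
    a = \sum_(p <- t) val p.2 /\ forall p, p \in t -> homact p.1 p.2.
Proof.
elim=> [u [g hg ->]||c u w _ [t1 [-> h1]] _ [t2 [-> h2]]|u w _ [t1 [-> h1]] _ [t2 [-> h2]]].
- have [k hk] := homact_gen hg; exists [:: (k, Uq_gen q A d hg)].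
  by rewrite big_seq1; split=> // p; rewrite inE => /eqP ->.
- exists [:: (0, 1%:A)]; split=> [|p]; first by rewrite big_seq1 scale1r.
  by rewrite inE => /eqP ->; exact: homact_scalar.
- exists ([seq (0 + p.1, c%:A * p.2) | p <- t1] ++ t2); split.
    rewrite big_cat big_map /= scaler_sumr; congr (_ + _); apply: eq_bigr => p _.
    by rewrite mulr_algl.
  move=> p; rewrite mem_cat => /orP[/mapP[p' /h1 hp ->]|/h2 //].
  exact: homactM (homact_scalar c) hp.
- exists [seq (p.1 + p'.1, p.2 * p'.2) | p <- t1, p' <- t2]; split.
    rewrite big_allpairs_dep /= mulr_suml; apply: eq_bigr => p _.
    by rewrite mulr_sumr.
  move=> p /allpairsP[[p1 p2] /= [/h1 ? /h2 ? ->]].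
  exact: homactM.
Qed.

Definition loop_sum (l : L) : V := \sum_(r <- msupp l) l@_r.

Lemma loop_sumEw (D : {fset int}) l : (msupp l `<=` D)%fset ->
  loop_sum l = \sum_(r <- D) l@_r.
Proof. by move=> lD; apply: big_fset_incl => // r _ /mcoeff_outdom. Qed.

Lemma loop_sumD l m : loop_sum (l + m) = loop_sum l + loop_sum m.
Proof.
rewrite (loop_sumEw (msuppD_le l m)) (loop_sumEw (fsubsetUl _ (msupp m))).
rewrite (loop_sumEw (fsubsetUr (msupp l) _)) -big_split /=.
by apply: eq_bigr => r _; rewrite mcoeffD.
Qed.

Lemma loop_sum0 : loop_sum 0 = 0.
Proof. by rewrite /loop_sum msupp0 big_seq_fset0. Qed.

Lemma loop_sumU v r : loop_sum << v *g r >> = v.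
Proof. by rewrite (loop_sumEw msuppU_le) big_seq_fset1 mcoeffUU. Qed.

Lemma loop_concentrated k r (l : L) : (forall j : int, j != 0 -> q ^ j != 1) ->
  Ue_gen q A d (GD true) *: (l : loop) =
    ((q ^ (k + (dd + r)))%:A : Ue) *: (l : loop) ->
  l = << loop_sum l *g r + k >>.
Proof.
move=> hq Dl.
have l0 s : s != r + k -> l@_s = 0.
  move=> hs.
  have e1 : (Ue_gen q A d (GD true) *: (l : loop) : L)@_s =
      ((q ^ (dd + s))%:A : Uq) *: l@_s.
    transitivity (loop_gen (GD true) l)@_s.
      by congr (_@_s); apply: etrans (loop_act_pi _ _) _; exact: loop_free_gen.
    by rewrite loop_shiftE subr0 /sgi mul1r.
  have e2 : (((q ^ (k + (dd + r)))%:A : Ue) *: (l : loop) : L)@_s =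
      ((q ^ (k + (dd + r)))%:A : Uq) *: l@_s.
    by rewrite loop_act_scalar loop_scaleE.
  have := e1; rewrite Dl e2 => /eqP; rewrite -subr_eq0 -scalerBl -scalerBl.
  set c := _ - _; have c0 : c != 0.
    apply: (expz_sub_neq0 q_neq0 hq); apply: contraNneq hs => e.
    by apply/eqP; apply: (addrI dd); rewrite -e; ring.
  by move/eqP; exact: scalar_eq0 c0.
have ll : l = << l@_(r + k) *g r + k >>.
  apply/malgP => s; rewrite mcoeffU; case: (r + k =P s) => [->|/eqP h].
    by rewrite mulr1n.
  by rewrite eq_sym in h; rewrite mulr0n; exact: l0 h.
by rewrite {2}ll loop_sumU.
Qed.

(* the defining formula of L(V; dd) *)
Lemma loop_actE k u v r : (forall j : int, j != 0 -> q ^ j != 1) ->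
  Uq_homog k u ->
  (val u : Ue) *: loop_tensor v r = loop_tensor (u *: v) (r + k).
Proof.
move=> hq hu; have [t [eu ht]] := homact_dec (subalgP u).
have eV : u = \sum_(p <- t) p.2.
  by apply: val_inj; rewrite raddf_sum.
pose x := loop_tensor v r.
pose l : L := (val u : Ue) *: x.
have el : l = \sum_(p <- t) << p.2 *: v *g r + p.1 >>.
  rewrite /l eu scaler_suml !big_seq; apply: eq_bigr => p /ht; exact.
have sl : loop_sum l = u *: v.
  rewrite el (big_morph _ loop_sumD loop_sum0) eV scaler_suml.
  by apply: eq_bigr => p _; rewrite loop_sumU.
have DuE : Ue_gen q A d (GD true) * (val u : Ue) =
    (q ^ k) *: ((val u : Ue) * Ue_gen q A d (GD true)).
  rewrite scalerAl -hu -[RHS]mulrA.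
  have -> : Ue_gen q A d (GD false) * Ue_gen q A d (GD true) = 1.
    rewrite /Ue_gen -rmorphM -[RHS](rmorph1 pi).
    by apply: (iffRL (@pres_piP _ _ (Upres q A d) _ _)); apply/ideal2_rel/Urel_D'D.
  by rewrite mulr1.
have Dx : Ue_gen q A d (GD true) *: x = ((q ^ (dd + r))%:A : Ue) *: x.
  rewrite loop_actDE; apply: esym; apply: etrans (loop_act_scalar _ _) _.
  by rewrite /loop_scale /x /loop_tensor loop_shiftU addr0.
have qE : q ^ (k + (dd + r)) = q ^ k * q ^ (dd + r) by exact: expfzDr.
have Dl := quasi_comm_scale DuE Dx; rewrite -qE in Dl.
apply: etrans (loop_concentrated hq Dl) _.
by rewrite -[in LHS]/l sl.
Qed.
End LoopModule.

(* ------------------------------------------------------------------ *)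
Section Modules.
Variables (A : nzRingType) (M : lmodType A).
Local Open Scope classical_set_scope.

Definition is_submodule (W : set M) : Prop :=
  W 0 /\ forall (a : A) u w, W u -> W w -> W (a *: u + w).

Definition irreducible_sub (W : set M) : Prop :=
  [/\ is_submodule W, exists2 w, W w & w != 0 &
      forall W', is_submodule W' -> W' `<=` W -> W' = [set 0] \/ W' = W].

Definition irreducible_mod : Prop := irreducible_sub [set: M].

Definition cyclic_sub (w : M) : set M := [set a *: w | a in [set: A]].

(* M is the internal direct sum of the subgroups W i; I may be infinite *)
Definition direct_sum (I : choiceType) (W : I -> set M) : Prop :=
  (forall v, exists (s : seq I) (f : I -> M),
     [/\ uniq s, forall i, i \in s -> W i (f i) & v = \sum_(i <- s) f i]) /\
  (forall (s : seq I) (f : I -> M), uniq s ->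
     (forall i, i \in s -> W i (f i)) -> \sum_(i <- s) f i = 0 ->
     forall i, i \in s -> f i = 0).
End Modules.

Section UqModules.
Variables (F : fieldType) (q : F).
Variables (n : nat) (A : 'M[int]_n) (d : 'I_n -> nat).
Local Notation Uq := (Uq q A d).
Variable V : lmodType Uq.

Definition findim_mod : Prop := exists (N : nat) (b : 'I_N -> V),
  forall v, exists c : 'I_N -> F, v = \sum_i ((c i)%:A : Uq) *: b i.

(* mu = \sum_i mu_i varpi_i *)
Definition weight_space (mu : 'rV[int]_n) : set V :=
  fun v => forall i, UqK q A d true i *: v = ((qi q d i ^ mu 0 i)%:A : Uq) *: v.

Definition type1 : Prop := direct_sum weight_space.

Definition poly_pm (b : bool) (p : {poly F}) : {poly F} :=
  if b then p
  else let r := \poly_(k < size p) p`_((size p).-1 - k) in (r.[0])^-1 *: r.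

(* For irreducible V this says V is isomorphic to V(pi). *)
Definition highest_loop_weight (pi : 'I_n -> {poly F}) : Prop :=
  exists v : V,
    [/\ v != 0,
        forall w, exists u : Uq, w = u *: v,
        forall i k, UqX q A d true i k *: v = 0,
        forall i, UqK q A d true i *: v =
                  ((qi q d i ^+ (size (pi i)).-1)%:A : Uq) *: v
      & forall b i r, UqP q A d b i r *: v =
                      (((poly_pm b (pi i))`_r)%:A : Uq) *: v].
End UqModules.

(* ------------------------------------------------------------------ *)
Section LieAlgebras.
Variables (C : fieldType) (g : vectType C) (br : g -> g -> g).

Definition is_lie_bracket : Prop :=
  [/\ forall x, linear (br x), forall x, linear (br^~ x),
      forall x, br x x = 0
    & forall x y z, br x (br y z) + br y (br z x) + br z (br x y) = 0].

Definition simple_lie : Prop :=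
  [/\ is_lie_bracket, exists x y, br x y != 0
    & forall I : {vspace g}, (forall x y, y \in I -> br x y \in I) ->
        I = 0%VS \/ I = fullv].

(* n is the rank of g and A its Cartan matrix, as witnessed by Chevalley
   generators: the span of the h_i is a Cartan subalgebra, e_j spans the root
   space of a simple root alpha_j, h_i is the coroot of alpha_i and
   A i j = alpha_j (h_i). *)
Definition cartan_matrix_of (n : nat) (A : 'M[int]_n) : Prop :=
  exists e f h : 'I_n -> g,
    [/\ free [seq h i | i <- enum 'I_n],
        forall i, A i i = 2,
        [/\ forall i j, br (h i) (h j) = 0,
            forall i j, br (e i) (f j) = if i == j then h i else 0,
            forall i j, br (h i) (e j) = (A i j)%:~R *: e j
          & forall i j, br (h i) (f j) = - (A i j)%:~R *: f j]
      & forall S : {vspace g}, (forall x y, x \in S -> y \in S -> br x y \in S) ->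
          (forall i, e i \in S /\ f i \in S) -> S = fullv].
End LieAlgebras.

Definition is_symmetrizer (n : nat) (A : 'M[int]_n) (d : 'I_n -> nat) : Prop :=
  (forall i, (0 < d i)%N) /\
  (forall i j, (d i)%:Z * A i j = (d j)%:Z * A j i).

Definition splits (F : fieldType) (p : {poly F}) : Prop :=
  exists s : seq F, p %= \prod_(a <- s) ('X - a%:P).

(* ------------------------------------------------------------------ *)
Definition Cq (R : realType) : fieldType := {fraction {poly R[i]}}.
Definition qvar (R : realType) : Cq R := tofrac 'X.

Lemma qvar_neq0 (R : realType) : qvar R != 0.
Proof. by rewrite /qvar tofrac_eq0 polyX_eq0. Qed.

Lemma qvar_generic (R : realType) (j : int) : j != 0 -> qvar R ^ j != 1.
Proof.
have h m : qvar R ^+ m.+1 != 1.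
  rewrite /qvar -tofracXn -tofrac1 tofrac_eq; apply/eqP.
  by move/(congr1 (fun p : {poly _} => size p)); rewrite size_polyXn size_poly1.
case: j => [[|m]|m] // _; first exact: h.
by rewrite NegzE -exprnN invr_eq1.
Qed.

(* Main.v *)
Require Import Defs.
From HB Require Import structures.
From mathcomp Require Import all_boot all_order all_algebra.
From mathcomp Require Import boolp classical_sets reals.
From mathcomp Require Import finmap.
From mathcomp.multinomials Require Import monalg.
From mathcomp.real_closed Require Import complex.
From mathcomp Require Import zify ring.

Set Implicit Arguments.
Unset Strict Implicit.
Unset Printing Implicit Defensive.

Import GRing.Theory.
Local Open Scope ring_scope.

(** Let [v] be the highest weight vector of [V]. Since [D] acts on
    [V (x) t^r] by the scalar [q^(dd + r)] and [q] is not a root of unity, the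
    submodules of the loop module are graded, and the vectors of degree [r] in
    [U_q^e (v (x) t^s)] are the [(u v) (x) t^r] with [u] homogeneous of degree
    [r - s] ([submodule_coef], [cyclic_coef]). Everything is thus governed by the
    set of the degrees [k] in which some homogeneous [u] satisfies [u v = v].
    It is closed under addition. If [pi i] has degree [N > 0], then [P_{i,N}]
    and [P_{i,-N}] multiply [v] by nonzero scalars, so that the set contains
    [N] and [-N] and equals [m Z] for some [m > 0] ([int_submonoid_period]).

    The other ingredient is that homogeneity can be preserved when returning to
    [v]. If [v] is a sum of vectors [y_i], then some [y_i] is mapped to [v] by
    an element of degree 0 ([extract_top]). Indeed, the weight space of [v] is
    a line: the vectors [x^-_{i_1,r_1} ... x^-_{i_k,r_k} v] span [V]
    ([lspan_act]), and for [k > 0] their weights differ from that of [v], the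
    Cartan matrix being nondegenerate ([cartan_weight_neq0]); a product of
    factors [K_i - c] projects onto this line, up to a scalar. Consequently every
    nonzero [y] in [V] is mapped to [v] by some homogeneous element: irreducibility
    of [V] gives [u] with [v = u y], and one decomposes [u] into homogeneous
    components ([hom_hit]).

    A nonzero submodule of [U_q^e (v (x) t^s)] therefore contains some
    [v (x) t^r]; then [m] divides [r - s], and it contains [v (x) t^s] as well,
    whence irreducibility. The sum over [0 <= s < m] is everything
    because [v (x) t^r] only matters for [r] modulo [m], and it is direct because a
    relation would make two distinct residues congruent modulo [m]. Finally, [m] is
    unique because it is the length of the loop module
    ([direct_sum_length_le]). *)

(** * Length of a semisimple module *)

Section Submodules.
Variables (A : nzRingType) (M : lmodType A) (W : set M).
Hypothesis subW : is_submodule W.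

Lemma submodule0 : W 0. Proof. by case: subW. Qed.

Lemma submoduleD x y : W x -> W y -> W (x + y).
Proof. by case: subW => _ h; rewrite -{2}[x]scale1r; exact: h. Qed.

Lemma submoduleZ a x : W x -> W (a *: x).
Proof. by case: subW => h0 h Wx; rewrite -[_ *: _]addr0; exact: h. Qed.

Lemma submoduleB x y : W x -> W y -> W (x - y).
Proof.
by move=> Wx Wy; rewrite -scaleN1r; apply: submoduleD => //; exact: submoduleZ.
Qed.

Lemma submodule_sum (I : eqType) (s : seq I) (P : pred I) (f : I -> M) :
  (forall i, i \in s -> P i -> W (f i)) -> W (\sum_(i <- s | P i) f i).
Proof.
move=> h; rewrite big_seq_cond; elim/big_ind: _ => [|x y|i /andP[]].
- exact: submodule0.
- exact: submoduleD.
- exact: h.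
Qed.
End Submodules.

Lemma cyclic_submodule (A : nzRingType) (M : lmodType A) (w : M) :
  is_submodule (cyclic_sub w).
Proof.
split; first by exists 0 => //; rewrite scale0r.
move=> a _ _ [b _ <-] [c _ <-]; exists (a * b + c) => //.
by rewrite scalerDl scalerA.
Qed.

Lemma cyclic_self (A : nzRingType) (M : lmodType A) (w : M) : cyclic_sub w w.
Proof. by exists 1 => //; rewrite scale1r. Qed.

Lemma irreducible_cyclic (A : nzRingType) (M : lmodType A) (W : set M) w x :
  irreducible_sub W -> W w -> w != 0 -> W x -> exists a : A, x = a *: w.
Proof.
case=> subW _ minW Ww w0 Wx.
have [|h|h] := minW _ (cyclic_submodule w).
- by move=> _ [a _ <-]; exact: submoduleZ.
- by have := cyclic_self w; rewrite h /= => e; rewrite e eqxx in w0.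
- by move: Wx; rewrite -h => -[a _ <-]; exists a.
Qed.

Section Length.
Variables (A : nzRingType) (M : lmodType A).
Local Open Scope classical_set_scope.

(** The steps of a filtration [Y] that the submodule [X] meets; over a
    composition series their number is the length of [X]. *)
Definition jumps (Y : nat -> set M) (m : nat) (X : set M) : {set 'I_m} :=
  finset (fun i : 'I_m => `[< exists x, [/\ X x, Y i.+1 x & ~ Y i x] >]).

Lemma jumpsS Y m (X X' : set M) : X `<=` X' -> jumps Y m X \subset jumps Y m X'.
Proof.
move=> XX'; apply/fintype.subsetP => i; rewrite !inE => /asboolP[x [h1 h2 h3]].
by apply/asboolP; exists x; split=> //; exact: XX'.
Qed.

(** Comparing [X] with [X'] inside the successive [Y i]: at a step which both
    meet, simplicity of the factor lets an element of [X] cancel one of [X']. *)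
Lemma jumps_inj (Y : nat -> set M) m (X X' : set M) :
  (forall x, Y 0%N x -> x = 0) -> (forall x, Y m x) ->
  (forall i x y, (i < m)%N -> Y i.+1 x -> ~ Y i x -> Y i.+1 y ->
     exists a, Y i (y - a *: x)) ->
  is_submodule X -> is_submodule X' -> X `<=` X' ->
  jumps Y m X' \subset jumps Y m X -> X' `<=` X.
Proof.
move=> Y0 Ym Ysimple sX sX' XX' /fintype.subsetP hj.
suff h i : (i <= m)%N -> forall x, X' x -> Y i x -> X x.
  by move=> x X'x; exact: (h m).
elim: i => [_ x _ /Y0 ->|i IH im y X'y Yy]; first exact: submodule0.
have [Yiy|Yiy] := pselect (Y i y); first exact: IH (ltnW im) _ X'y Yiy.
have /hj : Ordinal im \in jumps Y m X' by rewrite inE; apply/asboolP; exists y.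
rewrite inE => /asboolP[x [Xx Yx nYx]].
have [a ha] := Ysimple _ _ _ im Yx nYx Yy.
rewrite -(subrK (a *: x) y); apply: submoduleD => //; last exact: submoduleZ.
apply: IH (ltnW im) _ _ ha; apply: submoduleB => //.
by apply: submoduleZ => //; exact: XX'.
Qed.

Definition partial_sum m (W : 'I_m -> set M) (i : nat) : set M :=
  fun x => exists2 f : 'I_m -> M, forall s, W s (f s) &
    x = \sum_(s < m | (s < i)%N) f s.

Lemma partial_sum_submodule m (W : 'I_m -> set M) i :
  (forall s, is_submodule (W s)) -> is_submodule (partial_sum W i).
Proof.
move=> sW; split.
  exists (fun=> 0) => [s|]; first exact: submodule0.
  by rewrite big1.
move=> a _ _ [f hf ->] [g hg ->]; exists (fun s => a *: f s + g s) => [s|].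
  by apply: submoduleD => //; exact: submoduleZ.
by rewrite scaler_sumr -big_split.
Qed.

Lemma partial_sumS m (i : nat) (im : (i < m)%N) (f : 'I_m -> M) :
  \sum_(s < m | (s < i.+1)%N) f s =
    f (Ordinal im) + \sum_(s < m | (s < i)%N) f s.
Proof.
rewrite (bigD1 (Ordinal im)) ?ltnSn //=; congr (_ + _); apply: eq_bigl => s.
by rewrite -val_eqE /= ltnS andbC -ltn_neqAle.
Qed.

(** The partial sums of the second family form a strictly increasing chain, and
    the jumps along the first one separate its members. *)
Lemma direct_sum_length_le m m' (W : 'I_m -> set M) (W' : 'I_m' -> set M) :
  direct_sum W -> (forall s, irreducible_sub (W s)) ->
  direct_sum W' -> (forall s, irreducible_sub (W' s)) -> (m' <= m)%N.
Proof.
move=> [genW _] irrW [_ indW'] irrW'.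
have sW s : is_submodule (W s) by case: (irrW s).
have sW' s : is_submodule (W' s) by case: (irrW' s).
pose Y := partial_sum W; pose X := partial_sum W'.
have sY i : is_submodule (Y i) by exact: partial_sum_submodule.
have sX i : is_submodule (X i) by exact: partial_sum_submodule.
have Y0 x : Y 0%N x -> x = 0 by case=> f _ ->; rewrite big_pred0.
have Ym x : Y m x.
  have [s [f [us hf ->]]] := genW x.
  exists (fun i => if i \in s then f i else 0) => [i|].
    by case: ifP => [/hf //|_]; exact: submodule0.
  rewrite big_uniq //= -big_mkcondr /=; apply: eq_bigl => i.
  by rewrite ltn_ord.
have Ysimple i x y : (i < m)%N -> Y i.+1 x -> ~ Y i x -> Y i.+1 y ->
    exists a, Y i (y - a *: x).
  move=> im [f hf ->] nx [g hg ->].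
  have f0 : f (Ordinal im) != 0.
    apply: contra_notN nx => /eqP f0; exists f => //.
    by rewrite (partial_sumS im) f0 add0r.
  have [a ga] := irreducible_cyclic (irrW _) (hf _) f0 (hg (Ordinal im)).
  exists a; rewrite !(partial_sumS im) ga scalerDr opprD addrACA subrr add0r.
  apply: submoduleB => //; first by exists g.
  by apply: submoduleZ => //; exists f.
have XS i : X i `<=` X i.+1.
  move=> _ [f hf ->].
  exists (fun s : 'I_m' => if (s < i)%N then f s else 0) => [s|].
    by case: ifP => // _; exact: submodule0.
  rewrite -big_mkcondr; apply: eq_bigl => s.
  by rewrite andb_idl // => /ltnW.
have Xstrict i (im : (i < m')%N) : ~ (X i.+1 `<=` X i).
  case: (irrW' (Ordinal im)) => _ [w Ww w0] _ /(_ w) [].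
    exists (fun s => if s == Ordinal im then w else 0) => [s|].
      by case: eqP => [->|_] //; exact: submodule0.
    rewrite -big_mkcondr (big_pred1 (Ordinal im)) //= => s /=.
    by rewrite andb_idl // => /eqP->.
  move=> f hf ew.
  have := @indW' (enum 'I_m')
    (fun s : 'I_m' => if s == Ordinal im then w else if (s < i)%N then - f s else 0).
  move=> /(_ (enum_uniq _)) h; case/eqP: w0.
  have {h} := h _ _ (Ordinal im) (mem_enum _ _); rewrite eqxx; apply.
    move=> s _; case: eqP => [->|_] //; case: ifP => _; last exact: submodule0.
    by rewrite -sub0r; apply: submoduleB => //; exact: submodule0.
  rewrite big_enum /= (bigD1 (Ordinal im)) //= eqxx.
  rewrite [X in _ + X](eq_bigr (fun s : 'I_m' => if (s < i)%N then - f s else 0)).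
    rewrite -big_mkcondr [X in _ + X](eq_bigl (fun s : 'I_m' => (s < i)%N)).
      by rewrite sumrN -ew subrr.
    by move=> s /=; rewrite andb_idl // -val_eqE /= ltn_neqAle => /andP[].
  by move=> s /negbTE ->.
suff h i : (i <= m')%N -> (i <= #|jumps Y m (X i)|)%N.
  by apply: leq_trans (h _ (leqnn _)) _; rewrite -[X in (_ <= X)%N]card_ord max_card.
elim: i => // i IH im; apply: leq_ltn_trans (IH (ltnW im)) _.
apply: proper_card; rewrite properE jumpsS //=.
by apply/negP => /(jumps_inj Y0 Ym Ysimple (sX _) (sX _) (XS i)); exact: Xstrict.
Qed.
End Length.

(** * Nondegeneracy of the Cartan matrix *)

(** A relation [c] between the rows makes [\sum_i c i *: h i] commute with all
    Chevalley generators, hence central; but a simple Lie algebra has no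
    centre, and the [h i] are independent. *)
Lemma cartan_rows_free (C : fieldType) (g : vectType C) (br : g -> g -> g)
    (n : nat) (A : 'M[int]_n) :
  simple_lie br -> cartan_matrix_of br A ->
  forall c : 'I_n -> C, (forall j, \sum_i c i * (A i j)%:~R = 0) ->
  forall i, c i = 0.
Proof.
case=> -[brl brr br0 jac] [x0 [y0 nz]] simple [e [f [h [hfree _ [hh _ he hf] gen]]]] c hc.
have br0l y : br 0 y = 0.
  by have := brr y (-1) 0 0; rewrite scaler0 addr0 scaleN1r addNr.
have brZl y k x : br (k *: x) y = k *: br x y.
  by have := brr y k x 0; rewrite !addr0 br0l addr0.
have brDl y x z : br (x + z) y = br x y + br z y.
  by have /= := brr y 1 x z; rewrite !scale1r.
have brDr x y z : br x (y + z) = br x y + br x z.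
  by have := brl x 1 y z; rewrite !scale1r.
have br0r x : br x 0 = 0.
  by have := brl x (-1) 0 0; rewrite scaler0 addr0 scaleN1r addNr.
have brC x y : br x y = - br y x.
  apply/eqP; rewrite -addr_eq0.
  by have := br0 (x + y); rewrite brDl !brDr !br0 add0r addr0 => ->.
pose H := \sum_i c i *: h i.
have brH y : br H y = \sum_i c i *: br (h i) y.
  rewrite /H; elim/big_ind2: _ => [|x1 x2 y1 y2 <- <-|i _];
    [exact: br0l | exact: brDl | exact: brZl].
have He j : br H (e j) = 0.
  rewrite brH (eq_bigr (fun i => (c i * (A i j)%:~R) *: e j)); last first.
    by move=> i _; rewrite he scalerA.
  by rewrite -scaler_suml hc scale0r.
have Hf j : br H (f j) = 0.
  rewrite brH (eq_bigr (fun i => - (c i * (A i j)%:~R) *: f j)); last first.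
    by move=> i _; rewrite hf scalerA mulrN.
  by rewrite -scaler_suml sumrN hc oppr0 scale0r.
pose brH_linear := GRing.isLinear.Build C g g *:%R (br H) (brl H).
pose brHl : {linear g -> g} := HB.pack (br H) brH_linear.
pose adH := linfun brHl.
have kerE x : (x \in lker adH) = (br H x == 0).
  by rewrite memv_ker lfunE.
have Hcentral x : br H x = 0.
  apply/eqP; rewrite -kerE (gen (lker adH)) ?memvf // => [y z|i].
    rewrite !kerE => /eqP Hy /eqP Hz; have := jac H y z.
    by rewrite (brC z H) Hz Hy oppr0 !br0r !addr0 => ->.
  by rewrite !kerE He Hf.
have [|H0|Hfull] := simple <[H]>%VS.
- move=> x y /vlineP[k ->]; rewrite (brC x) brZl Hcentral scaler0 oppr0.
  exact: mem0v.
- have {}H0 : H = 0 by apply/eqP; rewrite -memv0 -H0 memv_line.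
  move: hfree; rewrite -[map _ _]/(tval (mktuple h)) => /freeP; apply.
  rewrite -[RHS]H0; apply: eq_bigr => i _; by rewrite -tnth_nth tnth_mktuple.
- case/eqP: nz.
  have /vlineP[k ->] : x0 \in <[H]>%VS by rewrite Hfull memvf.
  by rewrite brZl Hcentral scaler0.
Qed.

Lemma sum_count (R : pzRingType) (I : finType) (w : seq I) (F : I -> R) :
  \sum_(j <- w) F j = \sum_j F j * (count_mem j w)%:R.
Proof.
elim: w => [|a w IH]; first by rewrite big_nil big1 // => j _; rewrite mulr0.
rewrite big_cons IH [in RHS](eq_bigr (fun j =>
  F j * (a == j)%:R + F j * (count_mem j w)%:R)); last first.
  by move=> j _; rewrite /= natrD mulrDr.
rewrite big_split /= [in X in _ = X + _](bigD1 a) //= eqxx mulr1.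
rewrite [X in _ = _ + X + _]big1 ?addr0 // => j.
by rewrite eq_sym => /negbTE->; rewrite mulr0.
Qed.

(** A vanishing sum of simple roots would give a vector of multiplicities in the
    kernel of the invertible matrix [A], and multiplicities do not vanish in
    characteristic 0. *)
Lemma cartan_weight_neq0 (C : numFieldType) (g : vectType C) (br : g -> g -> g)
    (n : nat) (A : 'M[int]_n) :
  simple_lie br -> cartan_matrix_of br A ->
  forall w : seq 'I_n, w != [::] -> exists i, \sum_(j <- w) A i j != 0.
Proof.
move=> gs gA w w0; apply: contrapT => nz.
have z i : \sum_(j <- w) A i j = 0.
  by apply/eqP; apply: contrapT => /negP h; apply: nz; exists i.
pose AC := map_mx (intr : int -> C) A.
have Aunit : AC \in unitmx.
  rewrite -row_free_unit; apply: inj_row_free => c cA; apply/rowP => i.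
  rewrite mxE; apply: (cartan_rows_free gs gA (c := c 0)) => j.
  have := congr1 (fun u : 'rV_n => u 0 j) cA; rewrite !mxE => h.
  by apply: etrans h; apply: eq_bigr => k _; rewrite mxE.
pose x : 'cV[C]_n := \col_j (count_mem j w)%:R.
have Ax : AC *m x = 0.
  apply/colP => i; rewrite mxE [RHS]mxE -[RHS]/((0 : int)%:~R) -(z i).
  rewrite (sum_count w) rmorph_sum.
  by apply: eq_bigr => j _; rewrite !mxE rmorphM rmorph_nat.
have {Ax} x0 : x = 0 by rewrite -(mulKmx Aunit x) Ax mulmx0.
have w_count j : count_mem j w = 0%N.
  have /eqP := congr1 (fun u : 'cV_n => u j 0) x0.
  by rewrite !mxE Num.Theory.pnatr_eq0 => /eqP.
case: {x0 nz z x} w w0 w_count => // j w _ /(_ j).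
by rewrite /= eqxx.
Qed.

(** * Separating joint eigenvectors *)

Section ScalarAction.
Variables (F : fieldType) (U : algType F) (M : lmodType U).

Lemma act_scalarC (u : U) c (y : M) : u *: (c%:A *: y) = c%:A *: (u *: y).
Proof. by rewrite !scalerA mulr_algr mulr_algl. Qed.

Lemma act_scalarM a b (y : M) : (a%:A : U) *: ((b%:A : U) *: y) = (a * b)%:A *: y.
Proof. by rewrite scalerA mulr_algl scalerA. Qed.

Lemma act_scalarK c (y : M) : c != 0 -> (c^-1%:A : U) *: ((c%:A : U) *: y) = y.
Proof. by move=> c0; rewrite act_scalarM mulVf // !scale1r. Qed.

Lemma act_scaled c (u : U) (y : M) : (c *: u) *: y = (c%:A : U) *: (u *: y).
Proof. by rewrite scalerA mulr_algl. Qed.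
End ScalarAction.

Section Separation.
Variables (F : fieldType) (I : Type).

Definition eigen_prod (U : algType F) (kappa : I -> U) (s : seq (I * F)) : U :=
  \prod_(p <- s) (kappa p.1 - p.2%:A).

Lemma eigen_prodE (U : algType F) (M : lmodType U) (kappa : I -> U) (a : I -> F)
    (y : M) s :
  (forall i, kappa i *: y = (a i)%:A *: y) ->
  eigen_prod kappa s *: y = (\prod_(p <- s) (a p.1 - p.2))%:A *: y.
Proof.
move=> hy; rewrite /eigen_prod; elim: s => [|p s IH]; first by rewrite !big_nil !scale1r.
have step : (kappa p.1 - p.2%:A) *: y = (a p.1 - p.2)%:A *: y.
  by rewrite scalerBl hy -scalerBl -scalerBl.
have comm c : (kappa p.1 - p.2%:A) * c%:A = c%:A * (kappa p.1 - p.2%:A).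
  by rewrite mulr_algr mulr_algl.
rewrite !big_cons; set c := \prod_(p <- s) _ in IH *.
apply: etrans (esym (scalerA _ _ _)) _; rewrite IH.
apply: etrans (scalerA _ _ _) _; rewrite comm.
apply: etrans (esym (scalerA _ _ _)) _; rewrite step.
by apply: etrans (scalerA _ _ _) _; rewrite mulr_algl scalerA mulrC.
Qed.

(** With [eigen_prodE], the product attached to [s] kills the eigenvectors of
    characters [a j] and is invertible on those of character [a0]. *)
Lemma separating_prod (J : eqType) (t : seq J) (a : J -> I -> F) (a0 : I -> F) :
  (forall j, j \in t -> exists i, a j i != a0 i) ->
  exists s : seq (I * F), \prod_(p <- s) (a0 p.1 - p.2) != 0 /\
    forall j, j \in t -> \prod_(p <- s) (a j p.1 - p.2) = 0.
Proof.
elim: t => [_|j t IH h]; first by exists [::]; rewrite big_nil oner_neq0.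
have [|s [s0 sz]] := IH; first by move=> j' hj; apply: h; rewrite inE hj orbT.
have [|i hi] := h j; first by rewrite inE eqxx.
exists ((i, a j i) :: s); split.
  by rewrite big_cons mulf_neq0 // subr_eq0 eq_sym.
move=> j'; rewrite inE big_cons => /predU1P[->|/sz->]; last by rewrite mulr0.
by rewrite subrr mul0r.
Qed.
End Separation.

(** * Coefficients of exponentials *)

Section ExpCoef.
Variables (F : fieldType) (T : lalgType F).

(** [P j] stands for the elements of degree [j] of some grading; a constant [P]
    gives stability under any subalgebra. *)
Lemma exp_coef_graded (P : nat -> T -> Prop) (a : nat -> T) (r : nat) :
  (forall j, P j 0) -> P 0%N 1 ->
  (forall j u w, P j u -> P j w -> P j (u + w)) ->
  (forall j c u, P j u -> P j (c *: u)) ->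
  (forall i j u w, P i u -> P j w -> P (i + j)%N (u * w)) ->
  (forall s, P s (a s)) -> P r (exp_coef a r).
Proof.
move=> P0 P1 PD PZ PM Pa; rewrite /exp_coef.
elim/big_ind: _ => [||k _]; [exact: P0 | exact: PD | apply: PZ].
set p := \poly_(s < _) _.
have hp j : P j p`_j.
  rewrite coef_poly; case: ifP => _; last exact: P0.
  by case: ifP => _; [exact: P0 | exact: Pa].
suff Ppow e j : P j (p ^+ e)`_j by exact: Ppow.
elim: e j => [|e IH] j.
  by rewrite expr0 coef1; case: eqP => [->|_]; [exact: P1 | exact: P0].
rewrite exprS coefM; elim/big_ind: _ => [|u w|i _]; [exact: P0 | exact: PD |].
have := PM _ _ _ _ (hp i) (IH (j - i)%N).
by rewrite subnKC // -ltnS.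
Qed.

(** The recursion that recovers the exponent from the exponential: modulo
    products of lower coefficients, the coefficient of degree [r] is [a r]. *)
Lemma exp_coef_lead (S : T -> Prop) (a : nat -> T) (r : nat) :
  S 0 -> S 1 ->
  (forall u w, S u -> S w -> S (u + w)) -> (forall c u, S u -> S (c *: u)) ->
  (forall u w, S u -> S w -> S (u * w)) ->
  (0 < r)%N -> (forall s, (0 < s < r)%N -> S (a s)) -> S (exp_coef a r - a r).
Proof.
move=> S0 S1 SD SZ SM; case: r => // r _ Sa.
rewrite /exp_coef big_ord_recl big_ord_recl /= expr0 coef1 scaler0 add0r.
rewrite !factS fact0 invr1 scale1r expr1 coef_poly ltnSn /= addrAC subrr add0r.
elim/big_ind: _ => [||k _]; [exact: S0 | exact: SD | apply: SZ].
set p := \poly_(s < _) _.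
have Sp j : (j <= r)%N -> S p`_j.
  rewrite coef_poly => jr; case: ifP => // _; case: eqP => // /eqP j0.
  by apply: Sa; rewrite lt0n j0.
have Spow e j : (j <= r)%N -> S (p ^+ e)`_j.
  elim: e j => [|e IH] j jr; first by rewrite expr0 coef1; case: eqP.
  rewrite exprS coefM; elim/big_ind: _ => // i _.
  apply: SM; first by apply: Sp; apply: leq_trans jr; rewrite -ltnS.
  by apply: IH; apply: leq_trans jr; exact: leq_subr.
have p0 : p`_0 = 0 by rewrite coef_poly.
rewrite exprS coefM; elim/big_ind: _ => // i _.
have [->|i0] := eqVneq (nat_of_ord i) 0%N; first by rewrite p0 mul0r.
have [->|ir] := eqVneq (nat_of_ord i) r.+1.
  by rewrite subnn exprS coef0M p0 mul0r mulr0.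
apply: SM; first by apply: Sp; rewrite -ltnS ltn_neqAle ir -ltnS ltn_ord.
by apply: Spow; rewrite leq_subLR; apply: etrans (ltn_add2r r 0 i) _; rewrite lt0n.
Qed.
End ExpCoef.

Lemma exp_coef_morph (F : fieldType) (T T' : lalgType F)
    (f : {rmorphism T -> T'}) (a : nat -> T) r : scalable f ->
  f (exp_coef a r) = exp_coef (f \o a) r.
Proof.
move=> fZ; rewrite /exp_coef (big_morph f (raddfD f) (raddf0 f)).
apply: eq_bigr => k _; rewrite fZ -coef_map rmorphXn /=.
congr (_ *: nth 0 (polyseq (_ ^+ _)) _).
apply/polyP => j; rewrite coef_map !coef_poly /=.
by case: ifP => _; [case: ifP => _|]; rewrite ?raddf0.
Qed.

(** * Generators and relations of the quantum loop algebra *)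

Section QuantumLoop.
Variables (F : fieldType) (q : F) (n : nat) (A : 'M[int]_n) (d : 'I_n -> nat).
Local Notation Uq := (Uq q A d).
Local Notation Ue := (Ue q A d).

Lemma Uq_ind (P : Uq -> Prop) :
  (forall g (hg : ~~ is_D g), P (Uq_gen q A d hg)) -> P 1 ->
  (forall c u w, P u -> P w -> P (c *: u + w)) ->
  (forall u w, P u -> P w -> P (u * w)) -> forall u, P u.
Proof.
move=> Pg P1 Pl Pm u.
suff [w e Pw] : exists2 w : Uq, val w = val u & P w by rewrite -(val_inj e).
elim: (subalgP u) => [_ [g hg ->]||c a b _ [w1 <- P1'] _ [w2 <- P2]|
  a b _ [w1 <- P1'] _ [w2 <- P2]].
- by exists (Uq_gen q A d hg).
- by exists 1.
- by exists (c *: w1 + w2) => //; exact: Pl.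
- by exists (w1 * w2) => //; exact: Pm.
Qed.

Lemma Ue_ind (P : Ue -> Prop) :
  (forall g, P (Ue_gen q A d g)) -> P 1 ->
  (forall c u w, P u -> P w -> P (c *: u + w)) ->
  (forall u w, P u -> P w -> P (u * w)) -> forall u, P u.
Proof.
move=> Pg P1 Pl Pm.
have P0 : P 0 by rewrite -(addNr 1) -scaleN1r; exact: Pl.
elim/pres_ind => a; rewrite (monalgE a).
rewrite (big_morph (pres_pi (Upres q A d)) (raddfD _) (raddf0 _)).
elim/big_ind: _ => [//|u w Pu Pw|w _]; first by rewrite -[u]scale1r; exact: Pl.
have -> : << a@_w *g w >> = a@_w *: << w >> :> {malg F[seq (Ugen n)]}.
  by apply/malgP => k; rewrite mcoeffZ !mcoeffU; case: eqP;
    rewrite ?mulr1n ?mulr0n ?mulr1 ?mulr0.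
rewrite linearZ -[X in P X]addr0; apply: Pl => //.
elim: w => [|g w IH].
  by have -> : << [::] >> = 1 :> {malg F[seq (Ugen n)]} by []; rewrite rmorph1.
have -> : << g :: w >> = fgen F g * << w >> :> {malg F[seq (Ugen n)]}.
  by rewrite malgM_def fgmulUU mulr1.
by rewrite rmorphM; apply: Pm => //; exact: Pg.
Qed.

Local Notation ppi := (pres_pi (Upres q A d)).

Lemma UqvalB (u w : Uq) : val (u - w) = val u - val w :> Ue.
Proof. exact: rmorphB. Qed.
Lemma UqvalM (u w : Uq) : val (u * w) = val u * val w :> Ue.
Proof. exact: rmorphM. Qed.
Lemma UqvalZ c (u : Uq) : val (c *: u) = c *: val u :> Ue.
Proof. exact: linearZ. Qed.
Lemma ppiB a b : ppi (a - b) = ppi a - ppi b. Proof. exact: rmorphB. Qed.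
Lemma ppiM a b : ppi (a * b) = ppi a * ppi b. Proof. exact: rmorphM. Qed.
Lemma ppiZ c a : ppi (c *: a) = c *: ppi a. Proof. exact: linearZ. Qed.

(** Transports to the subalgebra [U_q] a relation whose two sides lift to it. *)
Lemma Uq_rel (u w : Uq) a b : Urel q A d a b ->
  val u = pres_pi (Upres q A d) a -> val w = pres_pi (Upres q A d) b -> u = w.
Proof.
move=> hab hu hw; apply: val_inj; rewrite hu hw.
by apply/pres_piP/ideal2_rel.
Qed.

Lemma val_UqH i r : val (UqH q A d i r) = pres_pi (Upres q A d) (freeH F i r).
Proof.
rewrite /UqH /freeH; case: insubP => [r' _ _|_] //; by rewrite !raddf0.
Qed.

(** [psi] lives in the free algebra on the generators of [U_q^e]; this is the
    element of the subalgebra [U_q] with the same image, see [val_UqPsi]. *)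
Definition UqPsi (b : bool) (i : 'I_n) (r : int) : Uq :=
  if 0 <= sgi b * r then
    UqK q A d b i *
    exp_coef (fun s => ((sgi b)%:~R * (qi q d i - (qi q d i)^-1)) *:
                       UqH q A d i (sgi b * s)) `|r|
  else 0.

Lemma val_UqPsi b i r : val (UqPsi b i r) = pres_pi (Upres q A d) (psi q d b i r).
Proof.
rewrite /UqPsi /psi; case: ifP => _; last by rewrite !raddf0.
rewrite !rmorphM; congr (_ * _).
have valZ : scalable (val : Uq -> Ue) by move=> c u; exact: linearZ.
apply: etrans (exp_coef_morph _ _ valZ) _.
apply: etrans (esym (exp_coef_morph _ _ (@pres_pi_scalable _ _ (Upres q A d)))).
congr (exp_coef _ _); apply/funext => s /=.
by rewrite linearZ /= -val_UqH.
Qed.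

Lemma UqK'K i : UqK q A d false i * UqK q A d true i = 1.
Proof. by apply: Uq_rel (Urel_K'K q A d i) _ _; rewrite ?rmorph1 ?rmorphM. Qed.

Lemma UqKX b i j r :
  UqK q A d true i * UqX q A d b j r =
  (qi q d i ^ (sgi b * A i j)) *: (UqX q A d b j r * UqK q A d true i).
Proof.
have e : UqK q A d true i * UqX q A d b j r * UqK q A d false i =
    (qi q d i ^ (sgi b * A i j)) *: UqX q A d b j r.
  by apply: Uq_rel (Urel_KX q A d b i j r) _ _; rewrite ?linearZ ?rmorphM.
rewrite -[LHS]mulr1 -(UqK'K i) scalerAl -e.
exact: mulrA.
Qed.

Lemma UqHX b i j r s : r != 0 ->
  UqH q A d i r * UqX q A d b j s =
  UqX q A d b j s * UqH q A d i r +
  ((sgi b)%:~R / r%:~R * qnum q d i (r * A i j)) *: UqX q A d b j (r + s).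
Proof.
move=> r0; rewrite -[LHS](subrK (UqX q A d b j s * UqH q A d i r)) addrC.
congr (_ + _); apply: Uq_rel (Urel_HX q A d b i j s r0) _ _.
  by rewrite UqvalB !UqvalM ppiB !ppiM val_UqH.
by rewrite !linearZ.
Qed.

Lemma UqXX i j r s :
  UqX q A d true i r * UqX q A d false j s =
  UqX q A d false j s * UqX q A d true i r +
  (if i == j then (qi q d i - (qi q d i)^-1)^-1 *:
                  (UqPsi true i (r + s) - UqPsi false i (r + s)) else 0).
Proof.
rewrite -[LHS](subrK (UqX q A d false j s * UqX q A d true i r)) addrC.
congr (_ + _); apply: Uq_rel (Urel_XpXm q A d i j r s) _ _.
  by rewrite UqvalB !UqvalM ppiB !ppiM.
case: ifP => _; last by rewrite !raddf0.
by rewrite UqvalZ UqvalB ppiZ ppiB; congr (_ *: (_ - _)); exact: val_UqPsi.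
Qed.
End QuantumLoop.

(** * Lowering vectors and the highest weight line *)

Section QuantumLoop.
Variables (F : fieldType) (q : F) (n : nat) (A : 'M[int]_n) (d : 'I_n -> nat).
Local Notation Uq := (Uq q A d).

Section HighestWeight.
Hypothesis q_neq0 : q != 0.
Hypothesis q_gen : forall j : int, j != 0 -> q ^ j != 1.
Hypothesis d_gt0 : forall i, (0 < d i)%N.

Lemma qi_neq0 i : qi q d i != 0.
Proof. exact: expf_neq0. Qed.

Lemma qi_inj i : injective (fun k : int => qi q d i ^ k).
Proof.
move=> k l /= e; apply/eqP; apply: contrapT => /negP kl.
have qik (m : int) : qi q d i ^ m = q ^ ((d i)%:Z * m) by rewrite /qi exprnP exprz_exp.
suff /(expz_sub_neq0 q_neq0 q_gen) : (d i)%:Z * k != (d i)%:Z * l.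
  by rewrite -!qik e subrr eqxx.
have dz : (d i)%:Z != 0 by rewrite eqz_nat -lt0n.
by apply: contra_neq kl => /(mulfI dz).
Qed.

Lemma qnum_neq0 i (k : nat) : (0 < k)%N -> qnum q d i k != 0.
Proof.
move=> k0; rewrite /qnum mulf_neq0 // ?invr_eq0 subr_eq0.
  apply/eqP => /qi_inj /eqP; rewrite -addr_eq0 -PoszD; by case: k k0.
by apply/eqP => /(@qi_inj i 1 (-1)).
Qed.

Variable V : lmodType Uq.

Variables (v : V) (e : 'I_n -> int).
Hypothesis v_top : forall i k, UqX q A d true i k *: v = 0.
Hypothesis v_weight :
  forall i, UqK q A d true i *: v = ((qi q d i ^ e i)%:A : Uq) *: v.
Hypothesis v_P : forall b i r, exists c, UqP q A d b i r *: v = (c%:A : Uq) *: v.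

Definition scalar_on (u : Uq) : Prop := exists c, u *: v = (c%:A : Uq) *: v.

Lemma scalar_on0 : scalar_on 0.
Proof. by exists 0; rewrite !scale0r. Qed.
Lemma scalar_on1 : scalar_on 1.
Proof. by exists 1; rewrite !scale1r. Qed.
Lemma scalar_onD u w : scalar_on u -> scalar_on w -> scalar_on (u + w).
Proof. by case=> a ha [b hb]; exists (a + b); rewrite !scalerDl ha hb. Qed.
Lemma scalar_onM u w : scalar_on u -> scalar_on w -> scalar_on (u * w).
Proof.
case=> a ha [b hb]; exists (b * a).
by apply: etrans (esym (scalerA _ _ _)) _; rewrite hb act_scalarC ha act_scalarM.
Qed.
Lemma scalar_onZ c u : scalar_on u -> scalar_on (c *: u).
Proof.
by move=> hu; rewrite -mulr_algl; apply: scalar_onM => //; exists c.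
Qed.

(** The coefficients of [P_i] determine the [h_{i,r}] recursively, since the
    factors [q^r / [r]_i] are invertible. *)
Lemma scalar_onH i r : scalar_on (UqH q A d i r).
Proof.
have [->|r0] := eqVneq r 0.
  by rewrite /UqH insubF ?eqxx //; exact: scalar_on0.
pose b := 0 <= r.
have -> : r = sgi b * `|r|%N by rewrite /b /sgi; case: ifP; lia.
have : (0 < `|r|)%N by lia.
move: b `|r|%N => {r r0} b r.
elim/ltn_ind: r => r IH r0.
pose c k := - (q ^ (sgi b * k%:Z) / qnum q d i k).
have c0 k : (0 < k)%N -> c k != 0.
  by move=> k0; rewrite oppr_eq0 mulf_neq0 ?expfz_neq0 // invr_eq0 qnum_neq0.
pose a k := c k *: UqH q A d i (sgi b * k%:Z).
have aP : scalar_on (a r).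
  rewrite -[a r](subKr (UqP q A d b i r)) -scaleN1r.
  apply: scalar_onD; first exact: v_P.
  apply: scalar_onZ; apply: exp_coef_lead => //.
  - exact: scalar_on0.
  - exact: scalar_on1.
  - exact: scalar_onD.
  - exact: scalar_onZ.
  - exact: scalar_onM.
  - by move=> s /andP[s0 sr]; apply: scalar_onZ; exact: IH.
have -> : UqH q A d i (sgi b * r%:Z) = (c r)^-1 *: a r.
  by rewrite scalerA mulVf ?scale1r // c0.
exact: scalar_onZ.
Qed.

Definition lowering (w : seq ('I_n * int)) : V :=
  foldr (fun p y => UqX q A d false p.1 p.2 *: y) v w.

Definition low_weight (w : seq ('I_n * int)) (i : 'I_n) : F :=
  qi q d i ^ (e i - \sum_(p <- w) A i p.1).

Lemma lowering_weight w i :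
  UqK q A d true i *: lowering w = ((low_weight w i)%:A : Uq) *: lowering w.
Proof.
rewrite /low_weight; elim: w => [|p w IH]; first by rewrite big_nil subr0 v_weight.
rewrite /= scalerA UqKX act_scaled; apply: etrans (congr1 _ (esym (scalerA _ _ _))) _.
rewrite IH act_scalarC act_scalarM -expfzDr ?qi_neq0 // big_cons.
by congr ((qi q d i ^ _)%:A *: _); rewrite /sgi; ring.
Qed.

Definition lspan (y : V) : Prop := exists t : seq (F * seq ('I_n * int)),
  y = \sum_(p <- t) (p.1%:A : Uq) *: lowering p.2.

Lemma lspan_lowering w : lspan (lowering w).
Proof. by exists [:: (1, w)]; rewrite big_seq1 !scale1r. Qed.
Lemma lspan0 : lspan 0.
Proof. by exists [::]; rewrite big_nil. Qed.
Lemma lspanD y z : lspan y -> lspan z -> lspan (y + z).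
Proof. by case=> s -> [t ->]; exists (s ++ t); rewrite big_cat. Qed.
Lemma lspanZ c y : lspan y -> lspan ((c%:A : Uq) *: y).
Proof.
case=> s ->; exists [seq (c * p.1, p.2) | p <- s].
rewrite big_map scaler_sumr; apply: eq_bigr => p _ /=.
by rewrite act_scalarM.
Qed.

Definition preserves (u : Uq) : Prop := forall y, lspan y -> lspan (u *: y).

Lemma preservesP u : (forall w, lspan (u *: lowering w)) -> preserves u.
Proof.
move=> hu _ [t ->]; rewrite scaler_sumr.
elim/big_ind: _ => [||p _]; [exact: lspan0 | exact: lspanD |].
by rewrite act_scalarC; exact: lspanZ.
Qed.

Lemma preserves0 : preserves 0.
Proof. by move=> y _; rewrite scale0r; exact: lspan0. Qed.
Lemma preserves1 : preserves 1.
Proof. by move=> y; rewrite scale1r. Qed.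
Lemma preservesD u w : preserves u -> preserves w -> preserves (u + w).
Proof.
move=> hu hw y hy; rewrite scalerDl; apply: lspanD; [exact: hu | exact: hw].
Qed.
Lemma preservesM u w : preserves u -> preserves w -> preserves (u * w).
Proof. by move=> hu hw y hy; rewrite -[_ *: _]scalerA; exact/hu/hw. Qed.
Lemma preservesZ c u : preserves u -> preserves (c *: u).
Proof. by move=> hu y hy; rewrite -mulr_algl -[_ *: _]scalerA; exact/lspanZ/hu. Qed.

Lemma preservesXm i r : preserves (UqX q A d false i r).
Proof. by apply: preservesP => w; exact: lspan_lowering ((i, r) :: w). Qed.

Lemma preservesK b i : preserves (UqK q A d b i).
Proof.
apply: preservesP => w.
case: b; first by rewrite lowering_weight; exact/lspanZ/lspan_lowering.
have c0 : low_weight w i != 0 by rewrite expfz_neq0 ?qi_neq0.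
suff -> : UqK q A d false i *: lowering w = ((low_weight w i)^-1%:A : Uq) *: lowering w.
  exact/lspanZ/lspan_lowering.
have /(congr1 (fun y => ((low_weight w i)^-1%:A : Uq) *: (UqK q A d false i *: y))) :=
  lowering_weight w i.
rewrite [in RHS]act_scalarC act_scalarM mulVf // [in RHS]scale1r [in RHS]scale1r => <-.
by rewrite [UqK _ _ _ _ _ *: _]scalerA UqK'K scale1r.
Qed.

Lemma preservesH i r : preserves (UqH q A d i r).
Proof.
apply: preservesP => w; have [->|r0] := eqVneq r 0.
  by rewrite /UqH insubF ?eqxx // scale0r; exact: lspan0.
elim: w => [|p w IH].
  have [c hc] := scalar_onH i r.
  by rewrite /= hc; exact/lspanZ/(lspan_lowering [::]).
rewrite /= scalerA UqHX // scalerDl; apply: lspanD.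
  by rewrite -scalerA; exact: preservesXm.
by rewrite act_scaled; exact/lspanZ/(lspan_lowering ((p.1, r + p.2) :: w)).
Qed.

Lemma preservesPsi b i r : preserves (UqPsi q A d b i r).
Proof.
rewrite /UqPsi; case: ifP => _; last exact: preserves0.
apply: preservesM; first exact: preservesK.
apply: (@exp_coef_graded _ _ (fun=> preserves)) => [_|||||s].
- exact: preserves0.
- exact: preserves1.
- by move=> _; exact: preservesD.
- by move=> _; exact: preservesZ.
- by move=> _ _; exact: preservesM.
- by apply: preservesZ; exact: preservesH.
Qed.

Lemma preservesXp i r : preserves (UqX q A d true i r).
Proof.
apply: preservesP; elim=> [|p w IH]; first by rewrite v_top; exact: lspan0.
rewrite /= scalerA UqXX scalerDl; apply: lspanD.
  by rewrite -scalerA; exact: preservesXm.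
case: ifP => _; last by rewrite scale0r; exact: lspan0.
rewrite act_scaled; apply: lspanZ; rewrite -scaleN1r scalerDl.
apply: lspanD; first by apply: preservesPsi; exact: lspan_lowering.
by apply: preservesZ; [exact: preservesPsi | exact: lspan_lowering].
Qed.

(** The span of the lowering vectors is stable under all generators: [h] and
    [x^+] are moved to the right until they reach [v], and their commutators
    with [x^-] are a multiple of some [x^-] and a polynomial in the [K] and [h]. *)
Lemma lspan_act u : lspan (u *: v).
Proof.
suff: preserves u by apply; exact: (lspan_lowering [::]).
elim/Uq_ind: u => [g hg||c u w hu hw|u w].
- case: g hg => [[] i r|i [r r0]|b i|//] hg.
  + rewrite (_ : Uq_gen _ _ _ _ = UqX q A d true i r); last exact: val_inj.
    exact: preservesXp.
  + rewrite (_ : Uq_gen _ _ _ _ = UqX q A d false i r); last exact: val_inj.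
    exact: preservesXm.
  + rewrite (_ : Uq_gen _ _ _ _ = UqH q A d i r); first exact: preservesH.
    by rewrite /UqH insubT; exact: val_inj.
  + by rewrite (_ : Uq_gen _ _ _ _ = UqK q A d b i); [exact: preservesK | exact: val_inj].
- exact: preserves1.
- by apply: preservesD => //; exact: preservesZ.
- exact: preservesM.
Qed.

Hypothesis v_neq0 : v != 0.
Hypothesis v_gen : forall y : V, exists u : Uq, y = u *: v.
Hypothesis A_weight : forall w : seq 'I_n,
  w != [::] -> exists i, \sum_(j <- w) A i j != 0.

(** The weight lowered by [w] is a sum of simple roots, which nondegeneracy of
    [A] keeps away from 0. *)
Lemma low_weight_neq w : w != [::] -> exists i, low_weight w i != low_weight [::] i.
Proof.
move=> w0; have [|i hi] := A_weight (w := map fst w); first by case: (w) w0.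
exists i; apply: contra_neq hi => /qi_inj /eqP.
by rewrite big_nil subr0 -subr_eq0 addrAC subrr sub0r oppr_eq0 big_map => /eqP.
Qed.

Lemma lspan_all y : lspan y.
Proof. by have [u ->] := v_gen y; exact: lspan_act. Qed.

(** The weight space of [v] is the line of [v], as every other lowering vector
    has a different weight. A product of factors [K_i - c] kills all the lowering
    vectors other than [v] that occur in the [y i], hence maps each [y i] to a
    multiple of [v]; not all of these can vanish. *)
Lemma extract_top (I : eqType) (t : seq I) (y : I -> V) :
  v = \sum_(i <- t) y i ->
  exists2 i, i \in t & exists c s,
    ((c%:A : Uq) * eigen_prod (UqK q A d true) s) *: y i = v.
Proof.
move=> ev.
have [T hT] := boolp.choice (fun i => lspan_all (y i)).
pose W := [seq w <- flatten [seq [seq p.2 | p <- T i] | i <- t] | w != [::]].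
have [|s [s0 sW]] := @separating_prod F 'I_n _ W low_weight (low_weight [::]).
  by move=> w; rewrite mem_filter => /andP[/low_weight_neq].
set c0 := \prod_(p <- s) _ in s0.
pose E := eigen_prod (UqK q A d true) s.
have Elow w : E *: lowering w =
    ((\prod_(p <- s) (low_weight w p.1 - p.2))%:A : Uq) *: lowering w.
  by apply: eigen_prodE => i; exact: lowering_weight.
have Ey i : i \in t -> exists k, E *: y i = (k%:A : Uq) *: v.
  move=> it; exists (\sum_(p <- T i | p.2 == [::]) p.1 * c0).
  rewrite scaler_suml scaler_suml hT scaler_sumr [RHS]big_mkcond !big_seq.
  apply: eq_bigr => p pT; rewrite act_scalarC Elow act_scalarM.
  case: eqP => [->|/eqP p0] //.
  rewrite sW ?mulr0 ?scale0r ?scale0r // mem_filter p0; apply/flattenP.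
  by exists [seq p.2 | p <- T i]; apply/mapP; [exists i | exists p].
have Ev : E *: v = (c0%:A : Uq) *: v by exact: (Elow [::]).
apply: contrapT => nex; case/eqP: v_neq0.
apply: (scalar_eq0 (U := Uq) s0); rewrite -/c0 -Ev ev scaler_sumr big_seq big1 // => i it.
have [k ek] := Ey i it; rewrite ek.
have [->|k0] := eqVneq k 0; first by rewrite !scale0r.
case: nex; exists i => //; exists k^-1, s.
by rewrite -[LHS]scalerA -/E ek act_scalarM mulVf // !scale1r.
Qed.
End HighestWeight.
End QuantumLoop.

(** * Semigroups of integers *)

(** A submonoid that meets both sides of 0 is a group: for [k > 0], write
    [- k = (b - 1) k + k (- b)], and symmetrically for [k < 0]. Its least positive
    element then generates it. *)
Lemma int_submonoid_period (S : int -> Prop) (a b : nat) :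
  S 0 -> (forall k l, S k -> S l -> S (k + l)) ->
  (0 < a)%N -> S a%:Z -> (0 < b)%N -> S (- b%:Z) ->
  exists2 m : nat, (0 < m)%N & forall k, S k <-> (m%:Z %| k)%Z.
Proof.
move=> S0 SD a0 Sa b0 Sb.
have Sn k (j : nat) : S k -> S (j%:Z * k).
  move=> Sk; elim: j => [|j IH]; first by rewrite mul0r.
  by rewrite -addn1 PoszD mulrDl mul1r; exact: SD.
have SN k : S k -> S (- k).
  move=> Sk; case: k Sk => j Sj.
    have -> : - j%:Z = b.-1%:Z * j%:Z + j%:Z * (- b%:Z) by nia.
    by apply: SD; exact: Sn.
  have -> : - Negz j = a.-1%:Z * Negz j + j.+1%:Z * a%:Z by rewrite NegzE; nia.
  by apply: SD; exact: Sn.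
have SM k j : S k -> S (j * k).
  by case: j => j Sk; [exact: Sn | rewrite NegzE mulNr; apply/SN/Sn].
have exS : exists j, (0 < j)%N && `[< S j%:Z >] by exists a; rewrite a0; exact/asboolP.
case: (ex_minnP exS) => m /andP[m0 /asboolP Sm] minm.
exists m => // k; split=> [Sk|/dvdzP[j ->]]; last exact: SM.
have m0' : m%:Z != 0 by rewrite eqz_nat -lt0n.
have Sr : S (k %% m%:Z)%Z.
  have -> : (k %% m%:Z)%Z = k + - (k %/ m%:Z)%Z * m%:Z.
    by rewrite {2}(divz_eq k m%:Z); ring.
  by apply: SD => //; exact: SM.
apply/dvdz_mod0P; have := ltz_pmod k (d := m%:Z) m0; move: (modz_ge0 k m0') Sr.
case: (k %% m%:Z)%Z => // -[//|r] _ Sr; rewrite ltz_nat ltnNge minm //.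
exact/asboolP.
Qed.

(** * Decomposition of the loop module *)

Section LoopModule.
Variables (F : fieldType) (q : F) (q_neq0 : q != 0).
Hypothesis q_gen : forall j : int, j != 0 -> q ^ j != 1.
Variables (n : nat) (A : 'M[int]_n) (d : 'I_n -> nat).
Local Notation Uq := (Uq q A d).
Local Notation Ue := (Ue q A d).
Variables (V : lmodType Uq) (dd : int).
Local Notation L := {malg V[int]}.
Local Notation loopV := (loop q_neq0 V dd).
Local Notation t := (loop_tensor q_neq0 dd).
Local Notation hom := (homact q_neq0 V dd).

Lemma homact0 k : hom k 0.
Proof. by move=> v r; rewrite scale0r [_ *: _]scale0r /loop_tensor monalgU0. Qed.

Lemma homactD k u w : hom k u -> hom k w -> hom k (u + w).
Proof.
move=> hu hw v r.
rewrite [val (u + w)](rmorphD _) [LHS]scalerDl hu hw scalerDl.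
by rewrite /loop_tensor monalgUD.
Qed.

Lemma homactZ k c u : hom k u -> hom k (c *: u).
Proof.
move=> hu; rewrite -mulr_algl -[k]add0r.
by apply: homactM => //; exact: homact_scalar.
Qed.

Lemma homact1 : hom 0 1.
Proof. by rewrite -[1]scale1r; exact: homact_scalar. Qed.

Lemma loop_sumE (l : loopV) : l = \sum_(s <- msupp (l : L)) t (l : L)@_s s.
Proof. exact: monalgE. Qed.

Lemma homact_coef k u (l : loopV) r : hom k u ->
  ((val u : Ue) *: l : L)@_r = u *: (l : L)@_(r - k).
Proof.
move=> hu; rewrite -(loop_shiftE k (fun=> u)) /loop_shift.
congr (mcoeff _ _); rewrite {1}[l]loop_sumE [LHS]scaler_sumr.
by apply: eq_bigr => s _; rewrite hu.
Qed.

Lemma loop_coef_D b (l : loopV) r :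
  (Ue_gen q A d (GD b) *: l : L)@_r = ((q ^ (sgi b * (dd + r)))%:A : Uq) *: (l : L)@_r.
Proof.
transitivity (loop_gen dd (GD b) (l : L))@_r.
  by congr (_@_r); apply: etrans (loop_act_pi q_neq0 _ _ _) _; exact: loop_free_gen.
by rewrite loop_shiftE subr0.
Qed.

Lemma loop_coef_scale (c : F) (l : loopV) r :
  ((c%:A : Ue) *: l : L)@_r = (c%:A : Uq) *: (l : L)@_r.
Proof. by rewrite loop_act_scalar loop_scaleE. Qed.

(** A word in the generators acts homogeneously, its factors [D] only rescaling
    every degree. *)
Lemma cyclic_coef v s (l : loopV) : cyclic_sub (t v s) l ->
  forall r, exists2 u, hom (r - s) u & (l : L)@_r = u *: v.
Proof.
pose Q (l : loopV) := forall r, exists2 u, hom (r - s) u & (l : L)@_r = u *: v.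
have QZ c l' : Q l' -> Q ((c%:A : Ue) *: l').
  move=> h r; have [u hu e] := h r; exists (c *: u); first exact: homactZ.
  by rewrite loop_coef_scale e -act_scaled.
suff QA a : forall l', Q l' -> Q (a *: l').
  case=> a _ <-; apply: QA => r; rewrite mcoeffU.
  case: (s =P r) => [<-|_]; last by exists 0; [exact: homact0 | rewrite mulr0n scale0r].
  by exists 1; [rewrite subrr; exact: homact1 | rewrite mulr1n scale1r].
elim/Ue_ind: a => [g||c a b IHa IHb|a b IHa IHb] l' h.
- case hg: (is_D g).
    case: g hg => // b _ r; have [u hu e] := h r.
    rewrite loop_coef_D e -act_scaled; exists (q ^ (sgi b * (dd + r)) *: u) => //.
    exact: homactZ.
  have [k hk] := homact_gen q_neq0 V dd (negbT hg).
  move=> r; rewrite -[Ue_gen _ _ _ _]/(val (Uq_gen q A d (negbT hg))).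
  have [u hu e] := h (r - k); exists (Uq_gen q A d (negbT hg) * u).
    have -> : r - s = k + (r - k - s) by ring.
    exact: homactM.
  by rewrite (homact_coef _ _ hk) e scalerA.
- by rewrite scale1r.
- move=> r; have [u hu eu] := QZ c _ (IHa _ h) r; have [w hw ew] := IHb _ h r.
  exists (u + w); first exact: homactD.
  by rewrite scalerDl mcoeffD -mulr_algl -scalerA eu ew scalerDl.
- by rewrite -scalerA; exact/IHa/IHb.
Qed.

(** [D] separates the degrees, as [q] is not a root of unity. *)
Lemma submodule_coef (W : set loopV) l r :
  is_submodule W -> W l -> W (t (l : L)@_r r).
Proof.
move=> sW Wl.
have De (w : V) s : Ue_gen q A d (GD true) *: t w s = ((q ^ (dd + s))%:A : Ue) *: t w s.
  apply/malgP => j; apply: etrans (loop_coef_D _ _ _) _.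
  apply: etrans _ (esym (loop_coef_scale _ _ _)); rewrite !mcoeffU.
  by case: eqP => [->|_]; rewrite ?mul1r // mulr0n !scaler0.
pose a s (_ : unit) := q ^ (dd + s).
have [|p [p0 pz]] := @separating_prod F unit _ [seq s <- msupp (l : L) | s != r] a (a r).
  move=> s; rewrite mem_filter => /andP[sr _]; exists tt.
  rewrite -subr_eq0; apply: (expz_sub_neq0 q_neq0 q_gen).
  by apply: contra_neq sr => /addrI.
set c := \prod_(i <- p) _ in p0.
pose E := eigen_prod (fun=> Ue_gen q A d (GD true)) p.
have Et (w : V) s : E *: t w s = ((\prod_(i <- p) (a s i.1 - i.2))%:A : Ue) *: t w s.
  by apply: (eigen_prodE (a := a s)) => -[]; exact: De.
have [rl|rl] := boolP (r \in msupp (l : L)); last first.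
  by rewrite (mcoeff_outdom rl) /loop_tensor monalgU0; exact: (submodule0 sW).
have El : E *: l = (c%:A : Ue) *: t (l : L)@_r r.
  rewrite {1}[l]loop_sumE scaler_sumr (bigD1_seq r) //= Et -/c.
  rewrite [X in _ + X]big_seq_cond [X in _ + X]big1 ?addr0 //.
  move=> s /andP[sl sr]; rewrite Et pz ?scale0r ?scale0r //.
  by rewrite mem_filter sr.
have -> : t (l : L)@_r r = (c^-1%:A : Ue) *: (E *: l).
  by rewrite El act_scalarK.
by do 2!apply: submoduleZ => //.
Qed.

(* What the decomposition uses of the highest weight vector; [v_extract]
   follows from [extract_top], and [v_period] from [int_submonoid_period]. *)
Variables (v : V) (m : nat).
Hypothesis v_neq0 : v != 0.
Hypothesis v_gen : forall y : V, exists u : Uq, y = u *: v.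
Hypothesis v_hit : forall y : V, y != 0 -> exists u : Uq, v = u *: y.
Hypothesis v_extract : forall (I : eqType) (s : seq I) (y : I -> V),
  v = \sum_(i <- s) y i -> exists2 i, i \in s & exists2 u, hom 0 u & u *: y i = v.
Hypothesis v_period :
  forall k, (exists2 u, hom k u & u *: v = v) <-> (m%:Z %| k)%Z.

Lemma hom_sum (u : Uq) : exists s : seq (int * Uq),
  u = \sum_(p <- s) p.2 /\ forall p, p \in s -> hom p.1 p.2.
Proof.
have [s [eu hs]] := homact_dec q_neq0 V dd (subalgP u); exists s; split=> //.
by apply: val_inj; rewrite eu raddf_sum.
Qed.

(** Irreducibility of [V] gives an element that need not be homogeneous;
    [v_extract] selects one of its components. *)
Lemma hom_hit y : y != 0 -> exists k, exists2 u, hom k u & u *: y = v.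
Proof.
move=> /v_hit[u]; have [s [-> hs]] := hom_sum u; rewrite scaler_suml.
move=> /v_extract[p /hs hp [w hw e]].
by exists (0 + p.1), (w * p.2); [exact: homactM | rewrite -scalerA].
Qed.

(** A nonzero submodule contains some [v (x) t^r]; as this vector comes from
    [v (x) t^s], the period divides [r - s], so one can also go back. *)
Lemma cyclic_irreducible s : irreducible_sub (cyclic_sub (t v s)).
Proof.
split; first exact: cyclic_submodule.
  exists (t v s); first exact: cyclic_self.
  apply: contra_neq v_neq0 => /(congr1 (fun l : L => l@_s)).
  by rewrite mcoeffUU mcoeff0.
move=> W sW Wsub; have [[l Wl l0]|nW] := pselect (exists2 l, W l & l != 0); last first.
  left; apply/seteqP; split=> l /=; last by move=> ->; exact: submodule0.
  by move=> Wl; apply/eqP; apply: contrapT => /negP l0; apply: nW; exists l.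
right; apply/seteqP; split=> //.
have [r lr] : exists r, (l : L)@_r != 0.
  apply: contrapT => nr; case/eqP: l0; apply/malgP => r; rewrite mcoeff0.
  by apply/eqP; apply: contrapT => /negP h; apply: nr; exists r.
have [k [u hu e]] := hom_hit lr.
have Wv : W (t v (r + k)).
  by rewrite -e -hu; apply: submoduleZ => //; exact: submodule_coef.
have [w hw ew] := cyclic_coef (Wsub _ Wv) (r + k).
have [u' hu' e'] : exists2 u, hom (s - (r + k)) u & u *: v = v.
  apply/v_period; rewrite rpredBC; apply/v_period; exists w => //.
  by rewrite -ew mcoeffUU.
move=> _ [a _ <-]; apply: submoduleZ => //.
have -> : t v s = (val u' : Ue) *: t v (r + k) by rewrite hu' e' addrC subrK.
exact: submoduleZ.
Qed.

Hypothesis m_gt0 : (0 < m)%N.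

(** The degrees [s] and [s'] of two summands that meet would be congruent modulo
    the period. *)
Lemma cyclic_direct_sum :
  direct_sum (fun s : 'I_m => cyclic_sub (t v (nat_of_ord s)%:Z)).
Proof.
split=> [l|s f us hf f0].
  pose G (l : loopV) := exists f : 'I_m -> loopV,
    (forall s, cyclic_sub (t v (nat_of_ord s)%:Z) (f s)) /\ l = \sum_s f s.
  suff [f [hf ->]] : G l.
    exists (enum 'I_m), f; split=> //; first exact: enum_uniq.
    by rewrite big_enum.
  have sG s : is_submodule (cyclic_sub (t v s)) by exact: cyclic_submodule.
  have G0 : G 0.
    by exists (fun=> 0); split=> [s|]; [exact: submodule0 | rewrite big1].
  have GD l1 l2 : G l1 -> G l2 -> G (l1 + l2).
    move=> [f [hf ->]] [g [hg ->]]; exists (fun s => f s + g s).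
    by split=> [s|]; [exact: submoduleD | rewrite big_split].
  have GZ (a : Ue) l1 : G l1 -> G (a *: l1).
    move=> [f [hf ->]]; exists (fun s => a *: f s).
    by split=> [s|]; [exact: submoduleZ | rewrite scaler_sumr].
  rewrite [l]loop_sumE; elim/big_ind: _ => // r _.
  have [u ->] := v_gen (l : L)@_r.
  have [s [-> hs]] := hom_sum u; rewrite scaler_suml.
  have -> : t (\sum_(p <- s) p.2 *: v) r = \sum_(p <- s) t (p.2 *: v) r.
    have tD : {morph (fun w : V => t w r) : x y / x + y}.
      by move=> x y; rewrite /loop_tensor monalgUD.
    have t0 : t (0 : V) r = 0 by rewrite /loop_tensor monalgU0.
    exact: (big_morph (fun w : V => t w r) tD t0).
  rewrite big_seq; elim/big_ind: _ => // p /hs hp.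
  have -> : t (p.2 *: v) r = (val p.2 : Ue) *: t v (r - p.1) by rewrite hp subrK.
  (* [v (x) t^k] lies in the summand of the residue of [k] modulo [m]. *)
  apply: GZ; set k := r - p.1.
  have km : (`|(k %% m%:Z)%Z| < m)%N.
    by rewrite -ltz_nat gez0_abs ?modz_ge0 ?ltz_pmod // -lt0n.
  have ek : k = (k %% m%:Z)%Z + (k %/ m%:Z)%Z * m%:Z by rewrite addrC -divz_eq.
  have [u' hu' e'] := iffRL (v_period ((k %/ m%:Z)%Z * m%:Z)) (dvdz_mull _ (dvdzz _)).
  exists (fun s => if s == Ordinal km then t v k else 0); split=> [i|].
    case: eqP => [->|_]; last exact: submodule0.
    exists (val u') => //; rewrite hu' e' /= gez0_abs ?modz_ge0 //.
      by rewrite -ek.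
    by rewrite eqz_nat -lt0n.
  by rewrite -big_mkcond (big_pred1 (Ordinal km)).
(* In a relation with a nonzero term of index [i0], choose a degree [r] where
   that term is nonzero and map it to [v]; another index [i] must then occur in
   the expression of [v] by the remaining terms. *)
move=> i0 i0s; apply/malgP => r; rewrite mcoeff0; apply/eqP; apply: contrapT => /negP fr.
have [k [b hb eb]] := hom_hit fr.
have fE i : i \in s -> exists2 u, hom (r - i%:Z) u & (f i : L)@_r = u *: v.
  by move=> /hf /cyclic_coef; apply.
have mem i w : i \in s -> hom 0 w -> w *: (b *: (f i : L)@_r) = v ->
    (m%:Z %| k + r - i%:Z)%Z.
  move=> /fE[u hu ->] hw ew; apply/v_period; exists (w * (b * u)).
    by rewrite -[_ - _]add0r -addrA; apply: homactM => //; exact: homactM.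
  by rewrite -!scalerA.
have ev : v = \sum_(i <- [seq i <- s | i != i0]) - (b *: (f i : L)@_r).
  rewrite big_filter sumrN -eb; apply/eqP; rewrite -addr_eq0 -(bigD1_seq i0) //=.
  have coefD : {morph (fun l : L => l@_r) : x y / x + y} by move=> x y; exact: mcoeffD.
  have coef0 : (0 : L)@_r = 0 by exact: mcoeff0.
  by rewrite -scaler_sumr -(big_morph _ coefD coef0) [X in mcoeff _ X]f0 coef0 scaler0.
have [i + [w hw ew]] := v_extract ev.
rewrite mem_filter => /andP[ii0 si].
have d1 : (m%:Z %| k + r - i%:Z)%Z.
  apply: (mem i (- w)) => //; first by rewrite -scaleN1r; exact: homactZ.
  by rewrite scaleNr -scalerN.
have d0 : (m%:Z %| k + r - i0%:Z)%Z.
  by apply: (mem i0 1) => //; [exact: homact1 | rewrite scale1r].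
have : (m%:Z %| i%:Z - i0%:Z)%Z.
  have -> : i%:Z - i0%:Z = k + r - i0%:Z - (k + r - i%:Z) by ring.
  exact: rpredB.
rewrite dvdzE /= => dm; case/negP: ii0; rewrite -val_eqE /=.
have := ltn_ord i; have := ltn_ord i0.
have [z|z] := posnP `|i%:Z - i0%:Z|%N; first by lia.
have := dvdn_leq z dm; lia.
Qed.
End LoopModule.

(** * Degrees of the generators *)

Section Degrees.
Variables (F : fieldType) (q : F) (q_neq0 : q != 0).
Variables (n : nat) (A : 'M[int]_n) (d : 'I_n -> nat).
Local Notation Uq := (Uq q A d).
Variables (V : lmodType Uq) (dd : int).
Local Notation hom := (homact q_neq0 V dd).

Lemma homactK b i : hom 0 (UqK q A d b i).
Proof.
move=> v r; apply: etrans (loop_act_pi q_neq0 _ _ _) _.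
by apply: etrans (loop_free_gen _ _ _) _; rewrite /= loop_shiftU.
Qed.

Lemma homactH i r : hom r (UqH q A d i r).
Proof.
rewrite /UqH; case: insubP => [k hk <-|_]; last exact: homact0.
move=> v s; apply: etrans (loop_act_pi q_neq0 _ _ _) _.
apply: etrans (loop_free_gen _ _ _) _; rewrite /= loop_shiftU.
by rewrite /UqH valK.
Qed.

Lemma homactP b i r : hom (sgi b * r%:Z) (UqP q A d b i r).
Proof.
apply: (exp_coef_graded (P := fun j u => hom (sgi b * j%:Z) u)) => [j||||j k|s].
- exact: homact0.
- by rewrite mulr0; exact: homact1.
- by move=> j; exact: homactD.
- by move=> j; exact: homactZ.
- by move=> u w hu hw; rewrite PoszD mulrDr; exact: homactM.
- by apply: homactZ; exact: homactH.
Qed.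

Lemma homact_eigen_prod s : hom 0 (eigen_prod (UqK q A d true) s).
Proof.
rewrite /eigen_prod; elim/big_ind: _ => [|u w hu hw|p _]; first exact: homact1.
  by rewrite -[0]addr0; exact: homactM.
rewrite -scaleN1r; apply: homactD; first exact: homactK.
exact/homactZ/homact_scalar.
Qed.
End Degrees.

Lemma poly_pm_lead_neq0 (F : fieldType) b (p : {poly F}) :
  p`_0 = 1 -> (poly_pm b p)`_(size p).-1 != 0.
Proof.
move=> p0; have pn0 : p != 0.
  by apply: contra_eq_neq p0 => ->; rewrite coef0 eq_sym oner_neq0.
have lp : p`_(size p).-1 != 0 by rewrite -[_`__]/(lead_coef p) lead_coef_eq0.
case: b => //=; have sp : (0 < size p)%N by rewrite size_poly_gt0.
rewrite coefZ coef_poly ltn_predL sp subnn p0 mulr1 invr_eq0.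
by rewrite horner_coef0 coef_poly sp subn0.
Qed.

Theorem theorem1 (R : realType) (g : vectType R[i]) (br : g -> g -> g)
    (g_simple : simple_lie br)
    (n : nat) (A : 'M[int]_n) (A_cartan : cartan_matrix_of br A)
    (d : 'I_n -> nat) (d_sym : is_symmetrizer A d)
    (V : lmodType (Uq (qvar R) A d))
    (V_irr : irreducible_mod V) (V_fin : findim_mod V) (V_type1 : type1 V)
    (pi : 'I_n -> {poly Cq R})
    (pi_const : forall i, (pi i)`_0 = 1) (pi_splits : forall i, splits (pi i))
    (V_pi : highest_loop_weight V pi)
    (pi_nontrivial : exists i, pi i != 1)
    (k : int) :
  let L := loop (qvar_neq0 R) V k in
  let t (v : V) (r : int) : L := loop_tensor (qvar_neq0 R) k v r in
  exists! m : nat, (0 < m)%N /\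
    exists v : V,
      direct_sum (fun s : 'I_m => cyclic_sub (t v (nat_of_ord s)%:Z)) /\
      forall s : 'I_m, irreducible_sub (cyclic_sub (t v (nat_of_ord s)%:Z)).
Proof.
move=> L t; have [v [v0 v_gen v_top v_weight v_P]] := V_pi.
have [d_gt0 _] := d_sym; have q_gen := @qvar_generic R.
have v_hit y : y != 0 -> exists u : Uq (qvar R) A d, v = u *: y.
  by move=> y0; exact: (irreducible_cyclic V_irr).
have v_extract (I : eqType) (s : seq I) (y : I -> V) : v = \sum_(i <- s) y i ->
    exists2 i, i \in s & exists2 u, homact (qvar_neq0 R) V k 0 u & u *: y i = v.
  move=> /(extract_top (e := fun i => (size (pi i)).-1%:Z) (qvar_neq0 R) q_gen
    d_gt0 v_top v_weight) [].
  - by move=> b i r; exists (poly_pm b (pi i))`_r; exact: v_P.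
  - exact: v0.
  - exact: v_gen.
  - exact: (cartan_weight_neq0 g_simple A_cartan).
  move=> i si [c [w e]]; exists i => //.
  exists (c%:A * eigen_prod (UqK (qvar R) A d true) w) => //.
  rewrite -[0]addr0; apply: homactM; first exact: homact_scalar.
  exact: homact_eigen_prod.
have [i pi1] := pi_nontrivial.
have N0 : (0 < (size (pi i)).-1)%N.
  rewrite -subn1 subn_gt0 ltnNge; apply: contra pi1 => /size1_polyC ->.
  by rewrite pi_const.
(* [P_i] of degree [N] and [-N], with [N] the degree of [pi i], scale [v]. *)
have SN b :
    exists2 u, homact (qvar_neq0 R) V k (sgi b * (size (pi i)).-1%:Z) u & u *: v = v.
  have c0 := poly_pm_lead_neq0 b (pi_const i).
  exists (((poly_pm b (pi i))`_(size (pi i)).-1)^-1 *: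
          UqP (qvar R) A d b i (size (pi i)).-1).
    by apply: homactZ; exact: homactP.
  by rewrite act_scaled v_P act_scalarK.
have [|a b [u hu eu] [w hw ew]|//||//||m m0 v_period] := @int_submonoid_period
  (fun j => exists2 u, homact (qvar_neq0 R) V k j u & u *: v = v)
  (size (pi i)).-1 (size (pi i)).-1.
- by exists 1; [exact: homact1 | rewrite scale1r].
- by exists (u * w); [exact: homactM | rewrite -scalerA ew].
- by have := SN true; rewrite /sgi mul1r.
- by have := SN false; rewrite /sgi mulN1r.
have irr s := cyclic_irreducible q_gen v0 v_hit v_extract v_period s.
have dsum := cyclic_direct_sum v0 v_gen v_hit v_extract v_period m0.
exists m; split; first by split=> //; exists v; split=> // s; exact: irr.
move=> m' [_ [v' [dsum' irr']]]; apply/eqP; rewrite eqn_leq.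
apply/andP; split.
  by apply: (direct_sum_length_le dsum' irr' dsum) => s; exact: irr.
by apply: (direct_sum_length_le dsum _ dsum' irr') => s; exact: irr.
Qed.
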